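(* Let $\Bbbk$ be an algebraically closed field and let $X$ be an algebraic subvariety of $\mathbb{A}^n_{\Bbbk(\!(x)\!)}$ of dimension $m$. Then, for all non-negative integers $d$ and $h$, $$n_{d,h}(X)\le m(dh+d+h).$$
   Context: $\mathbb{N}$ contains $0$; $x$, $T$ are single indeterminates; $\Bbbk(\!(x)\!)$ is the field of formal Laurent series. $X$ is identified with its set of $\Bbbk(\!(x)\!)$-points, a subset of $\Bbbk(\!(x)\!)^n$. $\Bbbk\langle x\rangle$ denotes the ring of algebraic power series, i.e. elements of $\Bbbk[[x]]$ algebraic over $\Bbbk[x]$. For $f\in\Bbbk\langle x\rangle$, the kernel of $\Bbbk[x,T]\to\Bbbk\langle x\rangle$, $P\mapsto P(x,f)$, is a principal prime ideal; its generator (unique up to $\Bbbk^*$) is the minimal polynomial of $f$. The degree of $f$ is the degree in $T$, and the height of $f$ the degree in $x$, of its minimal polynomial. $\mathcal A(d,h)$ is the set of algebraic power series of degree $\le d$ and height $\le h$ and $\mathcal A(d,h)_0=\{f\in\mathcal A(d,h): f(0)=0\}$; one has $\mathcal A(d,h)=\mathbb{A}^1_\Bbbk\times\mathcal A(d,h)_0$ via $f\mapsto(f(0),f-f(0))$. $\mathcal A(d,h,e)$ is the set of $f\in\mathcal A(d,h)_0$ whose minimal polynomial $P$ satisfies $\operatorname{ord}\left(\frac{\partial P}{\partial T}(x,f)\right)=e$ ($x$-adic order); $\mathcal A(d,h)_0$ is the disjoint union of the $\mathcal A(d,h,e)$ for $e\le 2dh$. Identification of $\mathcal A(d,h)_0$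 with a subset of an affine space. Any $f\in\mathcal A(d,h,e)$ is written uniquely $f=f^{(0)}+x^ef^{(1)}$ with $f^{(0)}\in\Bbbk[x]$ of degree $\le e$, $f^{(0)}(0)=0$, and $f^{(1)}\in\Bbbk\langle x\rangle$, $f^{(1)}(0)=0$. The minimal polynomial $R$ of $f^{(1)}$ then satisfies $\deg_TR\le d$, $\deg_xR\le h+e(d-2)$, $R(0,0)=0$ and $\frac{\partial R}{\partial T}(0,0)\ne0$; normalize it by $\frac{\partial R}{\partial T}(0,0)=1$. Sending $f$ to the coefficients of $f^{(0)}$ and the remaining coefficients of $R$ gives an injective map $$\mathcal A(d,h,e)\to\mathbb{A}_\Bbbk^{e}\times\mathbb{A}_\Bbbk^{(d+1)(h+e(d-2)+1)-2}$$ (considered only when $\mathcal A(d,h,e)\ne\emptyset$). These finitely many affine spaces (for $e\le 2dh$) are embedded by closed affine-linear embeddings into a common affine space $\mathbb{A}_\Bbbk^{N(d,h)}$ so that the images of the sets $\mathcal A(d,h,e)$ for different $e$ are disjoint (for instance by adding a coordinate taking a different constant value for each $e$, and padding with zeros). In this way $\mathcal A(d,h)_0$ is identified with a subset of $\mathbb{A}_\Bbbk^{N(d,h)}$, and $\mathcal A(d,h)=\mathbb{A}^1_\Bbbk\times\mathcal A(d,h)_0$ with a subset of $\mathbb{A}_\Bbbk^{N(d,h)+1}$. For a subset $E\subset\Bbbk(\!(x)\!)^n$ put $E_{d,h}:=E\cap\mathcal A(d,h)^n$. Then $n_{d,h}(E)$ denotes the dimension of the Zariski closure of $E_{d,h}$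 in $\mathbb{A}_\Bbbk^{n(N(d,h)+1)}$ (with the convention $\dim\emptyset=-\infty$; in particular $n_{d,h}(E)=-\infty$ if $d=0$, since $\mathcal A(0,h)=\emptyset$). This dimension does not depend on the choice of embeddings. *)

(* Defs.v *)
From HB Require Import structures.
From mathcomp Require Import all_boot all_order all_algebra.
From mathcomp Require Import boolp classical_sets constructive_ereal.
(* The notations of mpoly and constructive_ereal cannot be loaded together. *)
From mathcomp Require Import -(notations) mpoly.

Set Implicit Arguments.
Unset Strict Implicit.
Unset Printing Implicit Defensive.

Import Order.TTheory GRing.Theory.
Local Open Scope ring_scope.
Local Open Scope classical_set_scope.

Notation "{ 'mpoly' F [ n ] }" := (mpoly n F)
  (at level 0, F at level 2, n at level 10,
   format "{ 'mpoly'  F [ n ] }") : type_scope.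

Record fps (k : fieldType) := Fps { fps_coef : nat -> k }.
Arguments Fps {k}.
Coercion fps_coef : fps >-> Funclass.

HB.instance Definition _ (k : fieldType) := gen_eqMixin (fps k).
HB.instance Definition _ (k : fieldType) := gen_choiceMixin (fps k).

Section FpsRing.
Variable k : fieldType.
Implicit Types f g h : fps k.

Lemma fpsP f g : f =1 g -> f = g.
Proof. by case: f g => [f] [g] /= /funext ->. Qed.

Definition fps_zero : fps k := Fps (fun=> 0).
Definition fps_opp f : fps k := Fps (fun i => - f i).
Definition fps_add f g : fps k := Fps (fun i => f i + g i).
Definition fps_one : fps k := Fps (fun i => (i == 0%N)%:R).
Definition fps_mul f g : fps k :=
  Fps (fun i => \sum_(j < i.+1) f j * g (i - j)%N).

Fact fps_addA : associative fps_add.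
Proof. by move=> f g h; apply: fpsP => i /=; rewrite addrA. Qed.
Fact fps_addC : commutative fps_add.
Proof. by move=> f g; apply: fpsP => i /=; rewrite addrC. Qed.
Fact fps_add0 : left_id fps_zero fps_add.
Proof. by move=> f; apply: fpsP => i /=; rewrite add0r. Qed.
Fact fps_addN : left_inverse fps_zero fps_opp fps_add.
Proof. by move=> f; apply: fpsP => i /=; rewrite addNr. Qed.

HB.instance Definition _ :=
  GRing.isZmodule.Build (fps k) fps_addA fps_addC fps_add0 fps_addN.

Let trunc N f : {poly k} := \poly_(i < N) f i.

Let fps_mulE N f g i : (i < N)%N -> fps_mul f g i = (trunc N f * trunc N g)`_i.
Proof.
move=> iN; rewrite coefM; apply: eq_bigr => j _ /=.
by rewrite !coef_poly (leq_ltn_trans (leq_subr _ _) iN)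
  (leq_trans (ltn_ord j)).
Qed.

Fact fps_mulA : associative fps_mul.
Proof.
move=> f g h; apply: fpsP => i.
rewrite (fps_mulE _ _ (ltnSn i)) (fps_mulE (fps_mul f g) _ (ltnSn i)).
transitivity ((trunc i.+1 f * (trunc i.+1 g * trunc i.+1 h))`_i).
  rewrite !coefM; apply: eq_bigr => j _; congr (_ * _).
  rewrite coef_poly ltnS leq_subr.
  by rewrite (@fps_mulE i.+1) // ltnS leq_subr.
rewrite mulrA !coefM; apply: eq_bigr => j _; congr (_ * _).
by rewrite coef_poly ltn_ord (@fps_mulE i.+1).
Qed.

Fact fps_mulC : commutative fps_mul.
Proof.
by move=> f g; apply: fpsP => i; rewrite !(fps_mulE _ _ (ltnSn i)) mulrC.
Qed.

Fact fps_mul1 : left_id fps_one fps_mul.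
Proof.
move=> f; apply: fpsP => i /=.
rewrite big_ord_recl /= mul1r subn0 big1 ?addr0 // => j _.
by rewrite mul0r.
Qed.

Fact fps_mulDl : left_distributive fps_mul fps_add.
Proof.
move=> f g h; apply: fpsP => i /=; rewrite -big_split /=.
by apply: eq_bigr => j _; rewrite mulrDl.
Qed.

Fact fps_one_neq0 : fps_one != 0.
Proof.
apply/eqP => /(congr1 (fun f : fps k => f 0%N)) /= /eqP.
by rewrite oner_eq0.
Qed.

HB.instance Definition _ := GRing.Zmodule_isComNzRing.Build (fps k)
  fps_mulA fps_mulC fps_mul1 fps_mulDl fps_one_neq0.

Definition fps_unit : {pred fps k} := fun f => `[< exists g, g * f = 1 >].
Definition fps_inv f : fps k :=
  if pselect (exists g, g * f = 1) is left e then projT1 (cid e) else f.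

Fact fps_mulV : {in fps_unit, left_inverse 1 fps_inv *%R}.
Proof.
move=> f /asboolP fU; rewrite /fps_inv.
by case: pselect => // e; case: cid.
Qed.
Fact fps_unitP f g : g * f = 1 -> fps_unit f.
Proof. by move=> gf; apply/asboolP; exists g. Qed.
Fact fps_inv_out : {in [predC fps_unit], fps_inv =1 id}.
Proof.
move=> f; rewrite inE => /asboolP fNU; rewrite /fps_inv.
by case: pselect.
Qed.

HB.instance Definition _ := GRing.ComNzRing_hasMulInverse.Build (fps k)
  fps_mulV fps_unitP fps_inv_out.

Definition has_order f (e : nat) : Prop :=
  f e != 0 /\ forall i, (i < e)%N -> f i = 0.

Lemma has_orderP f : f != 0 -> exists e, has_order f e.
Proof.
move=> f0; have ex : exists i, f i != 0.
  apply: contrapT => nex; case/eqP: f0; apply: fpsP => i /=.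
  by apply: contrapT => /eqP fi; apply: nex; exists i.
exists (ex_minn ex); case: ex_minnP => e fe emin; split=> // i ie.
by apply: contraTeq ie => /emin; rewrite -leqNgt.
Qed.

Fact fps_integral f g : f * g = 0 -> (f == 0) || (g == 0).
Proof.
move=> fg0; apply: contrapT => /negP; rewrite negb_or => /andP[].
move=> /has_orderP[a [fa fmin]] /has_orderP[b [gb gmin]].
have := congr1 (fun f : fps k => f (a + b)%N) fg0.
have aab : (a < (a + b).+1)%N by rewrite ltnS leq_addr.
rewrite /= (bigD1 (Ordinal aab)) //= addKn big1 ?addr0 => [/eqP|j].
  by rewrite mulf_eq0 (negPf fa) (negPf gb).
rewrite -val_eqE neq_ltn => /orP[/= ja|/= aj]; first by rewrite fmin ?mul0r.
by rewrite gmin ?mulr0 // ltn_subLR ?ltn_add2r // -ltnS.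
Qed.

HB.instance Definition _ :=
  GRing.ComUnitRing_isIntegral.Build (fps k) fps_integral.

Definition fps_of_poly (p : {poly k}) : fps k := Fps (fun i => p`_i).

End FpsRing.

Definition laurent (k : fieldType) : fieldType := {fraction fps k}.

Section Zariski.
Variables (F : fieldType) (n : nat).

Definition zeros (S : set {mpoly F[n]}) : set 'rV[F]_n :=
  [set v | forall p, S p -> meval (fun i => v 0 i) p = 0].

Definition vanishing (Z : set 'rV[F]_n) : set {mpoly F[n]} :=
  [set p | forall v, Z v -> meval (fun i => v 0 i) p = 0].

Definition zariski_closure (Z : set 'rV[F]_n) : set 'rV[F]_n :=
  zeros (vanishing Z).

(* r is the length of a chain P_0 < ... < P_r of prime ideals containing S;
   [idealr_closed] includes properness. *)
Definition prime_chain (S : set {mpoly F[n]}) (r : nat) : Prop :=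
  exists P : nat -> {pred {mpoly F[n]}},
    (forall i, (i <= r)%N ->
       [/\ idealr_closed (P i), prime_idealr_closed (P i)
         & forall p, S p -> p \in P i])
    /\ (forall i, (i < r)%N ->
       {subset P i <= P i.+1} /\ exists2 p, p \in P i.+1 & p \notin P i).

(* The dimension of the affine scheme defined by the equations S, that is, the
   Krull dimension of F[y_1, ..., y_n] / (S); it is -oo if 1 is in (S). *)
Definition krull_dim (S : set {mpoly F[n]}) : \bar int :=
  supremum -oo%E [set (r%:Z)%:E | r in prime_chain S].

(* The dimension of a closed set of points: that of its coordinate ring. *)
Definition zariski_dim (Z : set 'rV[F]_n) : \bar int :=
  krull_dim (vanishing Z).

End Zariski.

Section AlgebraicSeries.
Variable k : fieldType.
Implicit Types (f : fps k) (P Q R : {poly {poly k}}).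

(* Elements of {poly {poly k}} are polynomials in T with coefficients in k[x];
   this is Q(x, f). *)
Definition eval_xT Q f : fps k := (map_poly (@fps_of_poly k) Q).[f].

(* P generates the kernel of Q |-> Q(x, f); this kernel is nonzero exactly when
   f is algebraic. *)
Definition is_minpoly f P : Prop :=
  P != 0 /\ forall Q, eval_xT Q f = 0 <-> exists S, Q = S * P.

(* In the comments below, A(d, h), A(d, h)_0 and A(d, h, e) stand for the sets
   alg_series d h, alg_series0 d h and alg_series_ord d h e. *)
Definition alg_series (d h : nat) : set (fps k) :=
  [set f | exists P, [/\ is_minpoly f P, (size P <= d.+1)%N
                       & (sizeY P <= h.+1)%N]].

Definition alg_series0 (d h : nat) : set (fps k) :=
  [set f | alg_series d h f /\ f 0%N = 0].

Definition alg_series_ord (d h e : nat) : set (fps k) :=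
  [set f | alg_series0 d h f
    /\ exists2 P, is_minpoly f P & has_order (eval_xT P^`() f) e].

(* Upper bounds, over all e <= 2dh, for e and for h + e(d - 2). The truncated
   subtraction only matters for d <= 1, when A(d, h, e) is empty for e > 0. *)
Definition ord_bound (d h : nat) : nat := (2 * d * h)%N.
Definition height_bound (d h : nat) : nat := (h + ord_bound d h * (d - 2))%N.

(* N(d, h): 2dh + 1 coordinates separate the pieces A(d, h, e), the others are
   the coefficients of f^(0) and of R. *)
Definition dimN (d h : nat) : nat :=
  ((ord_bound d h).+1
   + (ord_bound d h + (height_bound d h).+1 * d.+1))%N.

(* v is the image in A^N(d, h) of f in A(d, h, e), for e <= 2dh. The first block
   of v is the e-th unit vector. The normalized coefficients R(0, 0) = 0 and
   dR/dT(0, 0) = 1 are kept, as constant coordinates; for the smaller values of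
   e, the coefficients of f^(0) and R beyond their degree bounds vanish, which
   pads v with zeros. *)
Definition chart (d h e : nat) f (v : 'rV[k]_(dimN d h)) : Prop :=
  exists (f0 : {poly k}) (f1 : fps k) (R : {poly {poly k}}),
    [/\ [/\ (size f0 <= e.+1)%N, f0.[0] = 0, f1 0%N = 0
          & f = fps_of_poly f0 + fps_of_poly 'X^e * f1],
        is_minpoly f1 R, R^`().[0].[0] = 1
      & v = row_mx (\row_(i < (ord_bound d h).+1) (i == e :> nat)%:R)
             (row_mx (\row_(i < ord_bound d h) f0`_i.+1)
               (mxvec (\matrix_(i < (height_bound d h).+1, j < d.+1)
                         R`_j`_i)))].

(* w is the image of f under A(d, h) = A^1 x A(d, h)_0 -> A^(1 + N(d, h)). *)
Definition coordinates (d h : nat) f (w : 'rV[k]_(1 + dimN d h)) : Prop :=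
  exists (e : nat) (v : 'rV[k]_(dimN d h)),
    let g := f - fps_of_poly (f 0%N)%:P in
    [/\ (e <= ord_bound d h)%N, alg_series_ord d h e g, chart e g v
      & w = row_mx (f 0%N)%:M v].

(* The image of E_(d, h) in A^(n(N(d, h) + 1)). *)
Definition bounded_points n (E : set 'rV[laurent k]_n) (d h : nat) :
    set 'rV[k]_(n * (1 + dimN d h)) :=
  [set z | exists f : 'I_n -> fps k,
    [/\ E (\row_i tofrac (f i)), forall i, alg_series d h (f i)
      & forall i, coordinates (f i) (row i (vec_mx z))]].

Definition ndh (d h : nat) n (E : set 'rV[laurent k]_n) : \bar int :=
  zariski_dim (zariski_closure (@bounded_points n E d h)).

End AlgebraicSeries.

(* Main.v *)
Require Import Defs.
From HB Require Import structures.
From mathcomp Require Import all_boot all_order all_algebra.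
From mathcomp Require Import boolp classical_sets functions constructive_ereal.
From mathcomp Require Import ring.
From mathcomp Require Import -(notations) mpoly.

Set Implicit Arguments.
Unset Strict Implicit.
Unset Printing Implicit Defensive.

Import Order.TTheory GRing.Theory.
Local Open Scope ring_scope.

(** Let E be the set of coordinate vectors of the points of X whose entries are
    algebraic series of degree at most d and height at most h, and consider a
    chain P_0 < ... < P_r of primes of k[z] that contain the ideal of E. The
    theorem follows from r <= s * (d * h + d + h), where s is the length of
    some chain of primes above the equations of X (bounded_points_chain).

    Generic point of E. In the ring of all functions from the affine space to k
    there is a prime ideal that contains the functions vanishing on E but no
    polynomial outside P_0 (generic_point). Its residue field K behaves like
    an ultrapower of k over E. For each point of E choose the series f_i, a
    polynomial P_i(x, T) of bidegree at most (h, d) with P_i(x, f_i) = 0 and a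
    coefficient equal to 1, the series f_i^(1) and its minimal polynomial R_i.
    All of these have images over K, called by the same names, which satisfy
    the same identities. The images of the coordinates z define a
    morphism from k[z] to K whose kernel is contained in P_0, so r of them are
    algebraically independent over k (chain_indep).

    Generic point of X. Since the f_i over K satisfy the equations of X
    (laurent_point), these equations are in the kernel of the morphism from
    k((x))[y] to K((x)) that maps y_i to f_i. Let B be a maximal set of indices
    for which the f_i are algebraically independent over k((x)), and s its
    cardinal. Above this kernel there is a chain of primes of length s
    (chain_above).

    Counting. For i in B the polynomial P_i has (d + 1)(h + 1) coefficients, one
    of which is 1. Let C be the algebraic closure in K of the field generated
    over k by the s(dh + d + h) others. A series over K that is a root of a
    nonzero polynomial over C[[x]] has its coefficients in C (root_fps_over).
    This applies to f_i for i in B, because of P_i, and then to the other f_j,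
    which are algebraic over k((x)) and the f_i with i in B. Finally R_j is the
    unique normalized solution of a linear system with coefficients in C
    (minpoly_box_free), so R_j is defined over C. Hence all coordinates of the
    generic point of E are in C, and the exchange lemma bounds the number r of
    independent ones by the number of generators (steinitz, indep_bound). *)

(** * Subfields that are algebraically closed in a field *)
Section SubRings.
Variable K : fieldType.

Section SubField.
Variable S : divringClosed K.
Record subfield := SubField { subfield_val :> K; _ : subfield_val \in S }.
HB.instance Definition _ := [isSub for subfield_val].
HB.instance Definition _ := [Choice of subfield by <:].
HB.instance Definition _ := [SubChoice_isSubIntegralDomain of subfield by <:].
HB.instance Definition _ := [SubIntegralDomain_isSubField of subfield by <:].
End SubField.

(** A subset closed under the field operations becomes the image of an abstract
    field, to which the results on algebraic elements apply. *)
Lemma subfield_image (S : {pred K}) : divring_closed S ->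
  exists (F : fieldType) (i : {rmorphism F -> K}),
    forall u, u \in S <-> exists a, i a = u.
Proof.
move=> Scl.
pose S' : divringClosed K := HB.pack S (GRing.isDivringClosed.Build K S Scl).
exists (subfield S'), (val : {rmorphism subfield S' -> K}) => u.
split=> [uS|[[a aS] <-] //].
by exists (Sub u (uS : u \in S')).
Qed.

Section SubRing.
Variable S : subringClosed K.
Record subring := SubRing { subring_val :> K; _ : subring_val \in S }.
HB.instance Definition _ := [isSub for subring_val].
HB.instance Definition _ := [Choice of subring by <:].
HB.instance Definition _ := [SubChoice_isSubComNzRing of subring by <:].
End SubRing.

Lemma subring_image (S : {pred K}) : subring_closed S ->
  exists (A : comNzRingType) (i : {rmorphism A -> K}),
    forall u, u \in S <-> exists a, i a = u.
Proof.
move=> Scl.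
pose S' : subringClosed K := HB.pack S (GRing.isSubringClosed.Build K S Scl).
exists (subring S'), (val : {rmorphism subring S' -> K}) => u.
split=> [uS|[[a aS] <-] //].
by exists (Sub u (uS : u \in S')).
Qed.

End SubRings.

Lemma lift_poly (A B : nzRingType) (i : {rmorphism A -> B}) (p : {poly B}) :
  (forall j, exists a, i a = p`_j) -> exists q, map_poly i q = p.
Proof.
move=> /choice[g gP]; exists (\poly_(j < size p) g j); apply/polyP => j.
rewrite coef_map coef_poly; case: ltnP => [_|jp]; first exact: gP.
by rewrite [RHS]nth_default ?raddf0.
Qed.

Section RelativeClosure.
Variable K : fieldType.
Implicit Types (A C : {pred K}) (u : K) (p : {poly K}).

Definition algebraic_over A : {pred K} :=
  [pred u | `[< exists p, [/\ forall j, p`_j \in A, p != 0 & root p u] >]].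

Definition closed_subfield C :=
  divring_closed C /\ {subset algebraic_over C <= C}.

Definition fractions A : {pred K} :=
  [pred u | `[< exists a b, [/\ a \in A, b \in A, b != 0 & u = a / b] >]].

Lemma sub_fractions A : subring_closed A -> {subset A <= fractions A}.
Proof.
by case=> A1 _ _ a aA; apply/asboolP; exists a, 1; rewrite oner_neq0 divr1.
Qed.

Lemma fractions_closed A : subring_closed A -> divring_closed (fractions A).
Proof.
move=> Acl.
pose A' : subringClosed K := HB.pack A (GRing.isSubringClosed.Build K A Acl).
split.
- by apply/asboolP; exists 1, 1; rewrite (@rpred1 _ A') oner_neq0 divr1.
- move=> _ _ /asboolP[a [b [aA bA b0 ->]]] /asboolP[a' [b' [aA' bA' b0' ->]]].
  apply/asboolP; exists (a * b' - a' * b), (b * b').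
  rewrite (@rpredB _ A') ?(@rpredM _ A') // mulf_neq0 //; split=> //.
  by rewrite -(mulNr a' b'^-1) addf_div // mulNr.
- move=> _ _ /asboolP[a [b [aA bA b0 ->]]] /asboolP[a' [b' [aA' bA' b0' ->]]].
  apply/asboolP; have [->|a'0] := eqVneq a' 0.
    exists 0, 1; rewrite (@rpred0 _ A') (@rpred1 _ A') oner_neq0; split=> //.
    by rewrite mul0r invr0 mulr0 mul0r.
  exists (a * b'), (b * a'); rewrite !(@rpredM _ A') // mulf_neq0 //; split=> //.
  by rewrite invf_div mulf_div.
Qed.

Lemma clear_denominators A p : subring_closed A ->
    (forall j, p`_j \in fractions A) ->
  exists c, [/\ c \in A, c != 0 & forall j, (c *: p)`_j \in A].
Proof.
move=> Acl pA.
have /choice[a /choice[b abP]] j := asboolP _ (pA j).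
pose A' : subringClosed K := HB.pack A (GRing.isSubringClosed.Build K A Acl).
have aA j : a j \in A' by case: (abP j).
have bA j : b j \in A' by case: (abP j).
exists (\prod_(j < size p) b j); split.
- exact: (@rpred_prod _ A').
- by apply/prodf_neq0 => j _; case: (abP j).
move=> j; rewrite coefZ; have [jp|jp] := ltnP j (size p); last first.
  by rewrite nth_default // mulr0; apply: (@rpred0 _ A').
have [_ _ bj0 ->] := abP j.
rewrite (bigD1 (Ordinal jp)) //= mulrAC mulrCA divff // mulr1.
by rewrite (@rpredM _ A') //; apply: (@rpred_prod _ A').
Qed.

Lemma subring_algebraic A : subring_closed A -> {subset A <= algebraic_over A}.
Proof.
move=> Acl u uA.
pose A' : subringClosed K := HB.pack A (GRing.isSubringClosed.Build K A Acl).
apply/asboolP; exists ('X - u%:P).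
rewrite polyXsubC_eq0 root_XsubC eqxx; split=> // j.
apply: (polyOverP (S := A') _ j).
by rewrite rpredB ?polyOverX // polyOverC.
Qed.

(** Up to denominators, being algebraic over a subring means being algebraic over
    its fraction field inside K; integral dependence over a field does the rest. *)
Lemma algebraic_closed_subfield A : subring_closed A -> closed_subfield (algebraic_over A).
Proof.
move=> Acl.
pose A' : subringClosed K := HB.pack A (GRing.isSubringClosed.Build K A Acl).
have Qcl := fractions_closed Acl.
have [F [i iP]] := subfield_image Qcl.
have algE u : u \in algebraic_over A <-> algebraicOver i u.
  split=> [/asboolP[p [pA p0 pu]]|[q q0 qu]].
    have [q qp] : exists q, map_poly i q = p.
      by apply: lift_poly => j; apply/iP/(sub_fractions Acl)/pA.
    exists q; last by rewrite qp.
    by apply: contra_neq p0 => q0; rewrite -qp q0 rmorph0.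
  have [|c [cA c0 qA]] := @clear_denominators A (map_poly i q) Acl.
    move=> j.
    by apply/iP; exists q`_j; rewrite coef_map.
  apply/asboolP; exists (c *: map_poly i q); split=> //.
    by rewrite scaler_eq0 negb_or c0 map_poly_eq0.
  by rewrite rootE hornerZ (rootP qu) mulr0.
split; first split.
- by apply/algE; apply: algebraic1.
- by move=> u v /algE ua /algE va; apply/algE; apply: algebraic_sub.
- by move=> u v /algE ua /algE va; apply/algE; apply: algebraic_div.
move=> u /asboolP[p [pa p0 pu]]; apply/algE/integral_algebraic.
apply: integral_root p0 pu _; apply/(integral_poly i) => j.
exact/integral_algebraic/algE.
Qed.

(** The relative algebraic closure in K of the field generated by A. As an
    intersection it is monotone and idempotent for free. *)
Definition rcl A : {pred K} :=
  [pred u | `[< forall C, closed_subfield C -> {subset A <= C} -> u \in C >]].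

Lemma rcl_closed A : closed_subfield (rcl A).
Proof.
split; first split.
- by apply/asboolP => C [[C1 _ _] _] _.
- move=> u v /asboolP uA /asboolP vA; apply/asboolP => C Ccl AC.
  by case: (Ccl) => -[_ CB _] _; apply: CB; [apply: uA|apply: vA].
- move=> u v /asboolP uA /asboolP vA; apply/asboolP => C Ccl AC.
  by case: (Ccl) => -[_ _ CM] _; apply: CM; [apply: uA|apply: vA].
move=> u /asboolP[p [pA p0 pu]]; apply/asboolP => C Ccl AC.
case: (Ccl) => _; apply; apply/asboolP; exists p; split=> // j.
by move: (pA j) => /asboolP; apply.
Qed.

Lemma sub_rcl A : {subset A <= rcl A}.
Proof. by move=> u uA; apply/asboolP => C _; apply. Qed.

Lemma rcl_min A C : closed_subfield C -> {subset A <= C} -> {subset rcl A <= C}.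
Proof. by move=> Ccl AC u /asboolP; apply. Qed.

Lemma rcl_sub A B : {subset A <= B} -> {subset rcl A <= rcl B}.
Proof.
by move=> AB; apply: rcl_min (rcl_closed B) _ => u /AB; apply: sub_rcl.
Qed.

Definition adjoin A b : {pred K} := [pred u | (u \in A) || (u == b)].

(** A relation between a and b over the closure of A can be read as an equation
    for a with coefficients polynomial in b, or for b with coefficients polynomial
    in a. If the second one degenerates, all its coefficients vanish at a, which
    makes a algebraic over A. *)
Lemma rcl_exchange A a b :
  a \in rcl (adjoin A b) -> a \notin rcl A -> b \in rcl (adjoin A a).
Proof.
move=> ab aA; have [Lcl Lalg] := rcl_closed A.
pose L : divringClosed K :=
  HB.pack (rcl A) (GRing.isDivringClosed.Build K (rcl A) Lcl).
have LA u : u \in rcl A -> u \in L by [].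
pose Lb : {pred K} := [pred u | `[< exists2 p, p \is a polyOver L & u = p.[b] >]].
have Lbcl : subring_closed Lb.
  split.
  - by apply/asboolP; exists 1; rewrite ?rpred1 ?hornerE.
  - move=> _ _ /asboolP[p pL ->] /asboolP[q qL ->].
    by apply/asboolP; exists (p - q); rewrite ?rpredB ?hornerE.
  - move=> _ _ /asboolP[p pL ->] /asboolP[q qL ->].
    by apply/asboolP; exists (p * q); rewrite ?rpredM ?hornerE.
have {ab} : a \in algebraic_over Lb.
  have Lbalg := algebraic_closed_subfield Lbcl.
  apply: (rcl_min Lbalg) ab => u uAb; apply: subring_algebraic Lbcl _ _.
  move: uAb; rewrite inE => /orP[uA|/eqP->].
    apply/asboolP; exists u%:P; last by rewrite hornerC.
    by rewrite polyOverC; apply: sub_rcl.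
  by apply/asboolP; exists 'X; rewrite ?polyOverX ?hornerX.
move=> /asboolP[p [pLb p0 pa]].
have /choice[q qP] : forall j, exists q, q \is a polyOver L /\ p`_j = q.[b].
  by move=> j; have /asboolP[q] := pLb j; exists q.
pose P : {poly {poly K}} := \poly_(j < size p) q j.
have Pcoef j i : P`_j`_i \in L.
  rewrite coef_poly; case: ifP => _; last by rewrite coef0 rpred0.
  by apply/polyOverP; case: (qP j).
have PbE : map_poly (horner_eval b) P = p.
  apply/polyP => j; rewrite coef_map coef_poly; case: ltnP => [_|jp].
    by rewrite /horner_eval; case: (qP j) => _ ->.
  by rewrite nth_default ?raddf0.
have P0 : P != 0.
  by apply: contra_neq p0 => P0; rewrite -PbE P0 rmorph0.
have La : {subset L <= rcl (adjoin A a)}.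
  by apply: rcl_sub => u uA; rewrite inE uA.
have [Lacl Laalg] := rcl_closed (adjoin A a).
pose L' : divringClosed K :=
  HB.pack (rcl (adjoin A a)) (GRing.isDivringClosed.Build K _ Lacl).
have aL' : a \in L' by apply: sub_rcl; rewrite inE eqxx orbT.
pose Qa := map_poly (horner_eval a) (swapXY P).
have [Qa0|Qa0] := eqVneq Qa 0; last first.
  apply: Laalg; apply/asboolP; exists Qa; split=> // [j|].
    rewrite coef_map /= /horner_eval; apply: (@rpred_horner _ L') => //.
    by apply/polyOverP => i; rewrite coef_swapXY; apply/La/Pcoef.
  rewrite rootE /Qa -horner_polyC -[_.[b]]/(P.[a, b]) -horner2_swapXY.
  by rewrite horner_swapXY PbE (rootP pa).
case/negP: aA; apply: Lalg.
have [j Pj0] : exists j, (swapXY P)`_j != 0.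
  exists (size (swapXY P)).-1; rewrite -lead_coefE lead_coef_eq0.
  by rewrite swapXY_eq0.
apply/asboolP; exists (swapXY P)`_j; split=> // [i|].
  by rewrite coef_swapXY; apply: Pcoef.
have := congr1 (fun r : {poly K} => r`_j) Qa0.
by rewrite coef_map coef0 rootE => /eqP.
Qed.

End RelativeClosure.

Lemma divring_subring (K : fieldType) (C : {pred K}) :
  divring_closed C -> subring_closed C.
Proof.
move=> Ccl.
pose C' : divringClosed K := HB.pack C (GRing.isDivringClosed.Build K C Ccl).
by split=> [|u v uC vC|u v uC vC];
  [apply: (@rpred1 _ C')|apply: (@rpredB _ C')|apply: (@rpredM _ C')].
Qed.

Section Steinitz.
Variable K : fieldType.
Implicit Types (A : {pred K}) (us zs : seq K).

Definition adjoins A us : {pred K} := [pred u | (u \in A) || (u \in us)].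

(** Steinitz: by exchange, the members of zs replace those of us one at a time, until
    either some member depends on the earlier ones or us is used up. *)
Lemma steinitz A us zs :
    {subset zs <= rcl (adjoins A us)} -> (size us < size zs)%N ->
  exists2 i, (i < size zs)%N & zs`_i \in rcl (adjoins A (take i zs)).
Proof.
have [n] := ubnP (size us); elim: n => // n IHn in A us zs *.
rewrite ltnS; case: zs => // z zs usn zsus lt_us_zs.
have [zA|zA] := boolP (z \in rcl A).
  by exists 0%N => //=; apply: rcl_sub zA => u uA; rewrite inE uA.
have ex_j : exists j, z \in rcl (adjoins A (take j us)).
  by exists (size us); rewrite take_size; apply: zsus; rewrite mem_head.
(* u is the first member of us with which z becomes dependent; z replaces it *)
case: (ex_minnP ex_j) => -[|j] zj jmin.
  case/negP: zA; apply: rcl_sub zj => u; rewrite take0.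
  by rewrite inE in_nil orbF.
have ltj : (j < size us)%N.
  rewrite ltnNge; apply/negP => lej.
  suff /jmin : z \in rcl (adjoins A (take j us)) by rewrite ltnn.
  by move: zj; rewrite !take_oversize // ltnW.
pose u := us`_j; pose B := adjoins A (take j us).
have uz : u \in rcl (adjoin B z).
  apply: rcl_exchange.
    apply: rcl_sub zj => v; rewrite (take_nth 0 ltj) !inE mem_rcons inE.
    by case: (v \in A); case: (v \in take _ _); case: (v == us`_j).
  by apply/negP => /jmin; rewrite ltnn.
pose us' := take j us ++ drop j.+1 us.
have sz' : size us = (size us').+1.
  by rewrite size_cat -addnS -[RHS]/(_ + _)%N -[in LHS](cat_take_drop j us)
    size_cat (drop_nth 0 ltj).
have sub_us : {subset us <= rcl (adjoins (adjoin A z) us')}.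
  move=> v; rewrite -[us in v \in us](cat_take_drop j) (drop_nth 0 ltj).
  rewrite mem_cat inE => /or3P[vus|/eqP->|vus].
  - by apply: sub_rcl; rewrite inE mem_cat vus orbT.
  - apply: rcl_sub uz => w; rewrite !inE mem_cat.
    by case: (w \in A); case: (w \in take _ _); case: (w == z).
  - by apply: sub_rcl; rewrite inE mem_cat vus !orbT.
have [|||i lti zsi] := IHn (adjoin A z) us' zs.
- by rewrite -ltnS -sz'.
- move=> v vzs; have vus : v \in rcl (adjoins A us).
    by apply: zsus; rewrite inE vzs orbT.
  apply: rcl_min (rcl_closed _) _ _ vus => w; rewrite inE => /orP[wA|].
    by apply: sub_rcl; rewrite !inE wA.
  exact: sub_us.
- by rewrite sz' in lt_us_zs.
exists i.+1 => //=; apply: rcl_sub zsi => w.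
by rewrite !inE orbA.
Qed.

End Steinitz.

(** * Fields from prime ideals and from fractions *)

Section FieldOfAPrime.

Definition integral_axiom (A : comNzRingType) :=
  forall x y : A, x * y = 0 -> (x == 0) || (y == 0).

Section DomainInField.
Variables (A : comNzRingType) (integralA : integral_axiom A).

(** An integral ring with classically chosen inverses; the proof is an argument so
    that the structures below can be attached to the type. *)
Definition domain_of (_ : integral_axiom A) : Type := A.
Local Notation D := (domain_of integralA).
HB.instance Definition _ := GRing.ComNzRing.on D.

Let inv_pred : {pred D} := fun x => `[< exists y, y * x = 1 >].
Let inv (x : D) : D :=
  if pselect (exists y, y * x = 1) is left e then projT1 (cid e) else x.

Let mulV : {in inv_pred, left_inverse 1 inv *%R}.
Proof.
by move=> x /asboolP xU; rewrite /inv; case: pselect => // e; case: cid.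
Qed.
Let unitP x y : y * x = 1 -> inv_pred x.
Proof. by move=> yx; apply/asboolP; exists y. Qed.
Let inv_out : {in [predC inv_pred], inv =1 id}.
Proof.
by move=> x; rewrite inE => /asboolP xNU; rewrite /inv; case: pselect.
Qed.
HB.instance Definition _ := GRing.ComNzRing_hasMulInverse.Build D
  mulV unitP inv_out.
HB.instance Definition _ := GRing.ComUnitRing_isIntegral.Build D integralA.

Lemma domain_in_field : exists (K : fieldType) (f : {rmorphism A -> K}),
  injective f.
Proof.
pose f : {rmorphism D -> {fraction D}} := @tofrac D.
exists {fraction D}, f => x y /eqP.
by rewrite tofrac_eq => /eqP.
Qed.

End DomainInField.

Lemma prime_field (R : comNzRingType) (P : {pred R}) :
    idealr_closed P -> prime_idealr_closed P ->
  exists (K : fieldType) (f : {rmorphism R -> K}),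
    forall u, (f u == 0) = (u \in P).
Proof.
move=> Pid Ppr.
pose I : prime_idealr R :=
  HB.pack P (isIdealr.Build R P Pid) (isPrimeIdealrClosed.Build R P Ppr).
have [K [f f_inj]] := domain_in_field (@Quotient.rquot_IdomainAxiom R I).
exists K, (f \o \pi_({ideal_quot I})%qT) => u /=.
rewrite -(raddf0 f) (inj_eq f_inj) -[u in RHS]subr0 (Quotient.idealrBE I).
by rewrite raddf0.
Qed.

End FieldOfAPrime.

Section FractionLift.
Variables (R : idomainType).

Lemma fractionP (u : {fraction R}) :
  exists a b : R, b != 0 /\ u = tofrac a / tofrac b.
Proof.
elim/quotW: u => r; exists (\n_r), (\d_r); split; first exact: denom_ratioP.
apply/(canRL (mulfK _)); first by rewrite tofrac_eq0 denom_ratioP.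
unlock tofrac; rewrite -[LHS]FracField.pi_mul; apply/eqmodP => /=.
rewrite FracField.equivfE /FracField.mulf !numden_Ratio ?mulr1 ?denom_ratioP ?oner_neq0 //.
by rewrite mulrC.
Qed.

Lemma fraction_lift (K : fieldType) (f : {rmorphism R -> K}) : injective f ->
  exists g : {rmorphism {fraction R} -> K}, forall a, g (tofrac a) = f a.
Proof.
move=> f_inj.
have f0 b : b != 0 -> f b != 0 by rewrite -(raddf0 f) (inj_eq f_inj).
have /choice[num /choice[den numdenP]] := fractionP.
have tf0 (b : R) : b != 0 -> tofrac b != 0 by rewrite tofrac_eq0.
pose g u := f (num u) / f (den u).
have gE a b : b != 0 -> g (tofrac a / tofrac b) = f a / f b.
  move=> b0; have [d0 uE] := numdenP (tofrac a / tofrac b); rewrite /g.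
  set u := tofrac a / tofrac b in d0 uE *.
  move/eqP: uE; rewrite {1}/u eqr_div ?tf0 // -!tofracM tofrac_eq => /eqP e.
  by apply/eqP; rewrite eqr_div ?f0 // -!rmorphM /= -e eq_sym.
have gT a : g (tofrac a) = f a.
  by rewrite -[tofrac a]divr1 -tofrac1 gE ?oner_neq0 // rmorph1 divr1.
have gB : zmod_morphism g.
  move=> u v; have [du uE] := numdenP u; have [dv vE] := numdenP v.
  have -> : u - v = tofrac (num u * den v - num v * den u) / tofrac (den u * den v).
    rewrite {1}uE {1}vE -mulNr addf_div ?tf0 // -tofracN -!tofracM -tofracD.
    by rewrite mulNr.
  rewrite gE ?mulf_neq0 // rmorphB !rmorphM /g /=.
  by rewrite -[in RHS]mulNr addf_div ?f0 // mulNr.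
have gM : monoid_morphism g.
  split=> [|u v]; first by rewrite -tofrac1 gT rmorph1.
  have [du uE] := numdenP u; have [dv vE] := numdenP v.
  have -> : u * v = tofrac (num u * num v) / tofrac (den u * den v).
    by rewrite {1}uE {1}vE mulf_div -!tofracM.
  by rewrite gE ?mulf_neq0 // !rmorphM /g /= mulf_div.
pose G : {rmorphism {fraction R} -> K} :=
  HB.pack g (GRing.isZmodMorphism.Build _ _ g gB)
    (GRing.isMonoidMorphism.Build _ _ g gM).
by exists G.
Qed.

End FractionLift.

(** * Prime ideals of polynomial rings and algebraic independence *)

Definition is_prime (R : comNzRingType) (P : {pred R}) :=
  idealr_closed P /\ prime_idealr_closed P.

(** An ideal maximal among those that contain I and avoid the multiplicative set S
    is prime: if u and v are outside, adding either of them makes the ideal meet S,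
    hence so does adding their product. *)
Lemma prime_avoiding (R : comNzRingType) (I S : R -> Prop) :
    I 0 -> (forall a u v, I u -> I v -> I (a * u + v)) ->
    S 1 -> (forall u v, S u -> S v -> S (u * v)) ->
    (forall u, I u -> S u -> False) ->
  exists P : {pred R}, [/\ idealr_closed P, prime_idealr_closed P,
    forall u, I u -> u \in P & forall u, S u -> u \notin P].
Proof.
move=> I0 ID S1 SM IS.
pose ideal (A : R -> Prop) := forall a u v, A u -> A v -> A (a * u + v).
(* Zorn is applied to sets A with I u A an ideal, so that the empty chain is
   harmless *)
pose good (A : R -> Prop) :=
  ideal (fun u => I u \/ A u) /\ forall u, A u -> S u -> False.
have [F Fgood Ftot|M [[Mid MS] Mmax]] := @Zorn_bigcup R good.
  split; last by move=> u [A /Fgood[_ AS] Au]; apply: AS.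
  move=> a u v [Iu|[A FA Au]] [Iv|[B FB Bv]].
  - by left; apply: ID.
  - have [Bid _] := Fgood _ FB.
    by have [|?] := Bid a u v (or_introl Iu) (or_intror Bv);
      [left|right; exists B].
  - have [Aid _] := Fgood _ FA.
    by have [|?] := Aid a u v (or_intror Au) (or_introl Iv);
      [left|right; exists A].
  - have [AB|BA] := Ftot _ _ FA FB.
      have [Bid _] := Fgood _ FB.
      by have [|?] := Bid a u v (or_intror (AB _ Au)) (or_intror Bv);
        [left|right; exists B].
    have [Aid _] := Fgood _ FA.
    by have [|?] := Aid a u v (or_intror Au) (or_intror (BA _ Bv));
      [left|right; exists A].
pose P : {pred R} := [pred u | `[< I u \/ M u >]].
have PP u : u \in P <-> I u \/ M u by split=> /asboolP.
have PS u : u \in P -> S u -> False by case/PP; [apply: IS|apply: MS].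
have Padd a u v : u \in P -> v \in P -> a * u + v \in P.
  by move=> /PP uP /PP vP; apply/PP/Mid.
have P0 : 0 \in P by apply/PP; left.
have PM a u : u \in P -> a * u \in P.
  by move=> uP; rewrite -[a * u]addr0; apply: Padd.
have big u : u \notin P -> exists a m, m \in P /\ S (a * u + m).
  move=> uP; apply: contrapT => nex.
  pose B : R -> Prop := fun v => exists a m, m \in P /\ v = a * u + m.
  apply: (Mmax B); last split.
  - split=> [v Mv|BM].
      by exists 0, v; rewrite mul0r add0r; split=> //; apply/PP; right.
    case/negP: uP; apply/PP; right; apply: BM.
    by exists 1, 0; rewrite mul1r addr0.
  - have IB v : I v \/ B v -> B v.
      case=> // Iv; exists 0, v; rewrite mul0r add0r; split=> //.
      by apply/PP; left.
    move=> a v w /IB[b [x [xP ->]]] /IB[c [y [yP ->]]]; right.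
    exists (a * b + c), (a * x + y); split; first by apply: Padd.
    by rewrite mulrDr mulrDl mulrA addrACA.
  - by move=> v [a [m [mP ->]]] Sv; apply: nex; exists a, m.
exists P; split.
- by split=> //; apply/negP => /PS; apply.
- move=> u v uvP; apply: contrapT => /negP; rewrite negb_or => /andP[uP vP].
  have [a [x [xP Sx]]] := big u uP; have [b [y [yP Sy]]] := big v vP.
  apply: (PS ((a * u + x) * (b * v + y))); last exact: SM.
  have -> : (a * u + x) * (b * v + y) =
      a * b * (u * v) + ((b * v + y) * x + a * u * y).
    by ring.
  apply: (Padd _ _ _ uvP); apply: (Padd _ _ _ xP); exact: PM.
- by move=> u Iu; apply/PP; left.
- by move=> u Su; apply/negP => /PS; apply.
Qed.

(** The polynomial ring F[x_j] through its two universal properties. Arguments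
    about variables are carried out in an abstract ring with these properties. *)
Record polynomial_ring (F : comNzRingType) (n : nat) (R : comNzRingType)
    (c_ : {rmorphism F -> R}) (x_ : 'I_n -> R) : Prop := PolynomialRing {
  polynomial_ring_eval : forall (S : comNzRingType) (f : {rmorphism F -> S})
    (y : 'I_n -> S), exists g : {rmorphism R -> S},
      (forall a, g (c_ a) = f a) /\ (forall j, g (x_ j) = y j);
  polynomial_ring_ind : forall C : {pred R}, subring_closed C ->
    (forall a, c_ a \in C) -> (forall j, x_ j \in C) -> forall p, p \in C }.

Lemma eq_poly_rmorph (F : comNzRingType) (n : nat) (R : comNzRingType)
    (c_ : {rmorphism F -> R}) (x_ : 'I_n -> R) (polR : polynomial_ring c_ x_)
    (S : comNzRingType) (f g : {rmorphism R -> S}) :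
    (forall a, f (c_ a) = g (c_ a)) -> (forall j, f (x_ j) = g (x_ j)) ->
  f =1 g.
Proof.
move=> fgC fgX p; apply/eqP.
apply: (polynomial_ring_ind polR (C := [pred p | f p == g p])) => [|a|j].
- split=> [|u v|u v]; rewrite !inE ?rmorph1 ?rmorphB ?rmorphM //.
    by move=> /eqP-> /eqP->.
  by move=> /eqP-> /eqP->.
- by rewrite inE fgC.
- by rewrite inE fgX.
Qed.

Section PolynomialRings.
Variables (F : fieldType) (n : nat) (R : idomainType).
Variables (c_ : {rmorphism F -> R}) (x_ : 'I_n -> R).
Hypothesis polR : polynomial_ring c_ x_.
Implicit Types (p q : R) (P Q : {pred R}).
Implicit Types (B : {set 'I_n}) (j : 'I_n).

Let restr_ex B := polynomial_ring_eval polR c_ (fun j => if j \in B then x_ j else 0).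
Definition restr B : {rmorphism R -> R} := projT1 (cid (restr_ex B)).

Definition invars B : {pred R} := [pred p | restr B p == p].

Let slice_ex j := polynomial_ring_eval polR (polyC \o c_)
  (fun i => if i == j then 'X else (x_ i)%:P).
(** A polynomial seen as a polynomial in x_j alone. *)
Definition slice j : {rmorphism R -> {poly R}} := projT1 (cid (slice_ex j)).

Lemma restrC B a : restr B (c_ a) = c_ a.
Proof. by rewrite /restr; case: cid => /= f []. Qed.

Lemma restrX B j : restr B (x_ j) = if j \in B then x_ j else 0.
Proof. by rewrite /restr; case: cid => /= f []. Qed.

Lemma sliceC j a : slice j (c_ a) = (c_ a)%:P.
Proof. by rewrite /slice; case: cid => /= f []. Qed.

Lemma sliceX j i : slice j (x_ i) = if i == j then 'X else (x_ i)%:P.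
Proof. by rewrite /slice; case: cid => /= f []. Qed.

Lemma invarsE B p : (p \in invars B) = (restr B p == p).
Proof. by []. Qed.

Lemma invars_subring B : subring_closed (invars B).
Proof.
split=> [|p q|p q]; rewrite !invarsE ?rmorph1 ?rmorphB ?rmorphM //.
  by move=> /eqP-> /eqP->.
by move=> /eqP-> /eqP->.
Qed.

HB.instance Definition _ B := GRing.isSubringClosed.Build _ (invars B)
  (invars_subring B).

Lemma invarsC B c : c_ c \in invars B.
Proof. by rewrite invarsE restrC. Qed.

Lemma invarsX B i : i \in B -> x_ i \in invars B.
Proof. by rewrite invarsE restrX => ->. Qed.

Lemma invarsS B B' : B \subset B' -> {subset invars B <= invars B'}.
Proof.
move=> /fintype.subsetP BB' p; rewrite invarsE => /eqP <-; rewrite invarsE; apply/eqP.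
apply: (@eq_poly_rmorph _ _ _ _ _ polR _ (restr B' \o restr B) (restr B)) => [c|i] /=.
  by rewrite !restrC.
by rewrite !restrX; case: ifP => iB; rewrite ?raddf0 ?restrX ?(BB' _ iB).
Qed.

Lemma invarsT p : p \in invars [set: 'I_n].
Proof.
rewrite invarsE; apply/eqP.
apply: (@eq_poly_rmorph _ _ _ _ _ polR _ (restr [set: 'I_n]) idfun) => [c|i] /=.
  by rewrite restrC.
by rewrite restrX inE.
Qed.

Lemma horner_slice j p : (slice j p).[x_ j] = p.
Proof.
rewrite -[LHS]/(horner_eval (x_ j) (slice j p)).
apply: (@eq_poly_rmorph _ _ _ _ _ polR _ (horner_eval (x_ j) \o slice j) idfun) => [c|i] /=.
  by rewrite sliceC /horner_eval hornerC.
by rewrite sliceX /horner_eval; case: eqVneq => [->|_]; rewrite ?hornerX ?hornerC.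
Qed.

Lemma slice_invars B j p : j \notin B -> p \in invars (j |: B) ->
  forall e, (slice j p)`_e \in invars B.
Proof.
move=> jB; rewrite invarsE => /eqP <- e; rewrite invarsE -coef_map; apply/eqP; congr (_`_e).
pose f : {rmorphism R -> {poly R}} :=
  slice j \o restr (j |: B).
suff E : map_poly (restr B) \o f =1 f by have := E p; rewrite /f /= => Ep; rewrite Ep.
apply: (eq_poly_rmorph polR) => [c|i] /=.
  by rewrite restrC sliceC map_polyC /= restrC.
rewrite restrX !inE; case: ifP => [|_]; last by rewrite !raddf0.
rewrite sliceX; have [_ _|_ /= iB] := eqVneq; first by rewrite map_polyX.
by rewrite map_polyC /= restrX iB.
Qed.

Lemma slice_polyC B j p : j \notin B -> p \in invars B -> slice j p = p%:P.
Proof.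
move=> jB; rewrite invarsE => /eqP <-.
apply: (@eq_poly_rmorph _ _ _ _ _ polR _ (slice j \o restr B) (polyC \o restr B)) => [c|i] /=.
  by rewrite restrC sliceC.
rewrite restrX; case: ifP => iB; last by rewrite !raddf0.
by rewrite sliceX; case: eqVneq => // ij; rewrite -ij iB in jB.
Qed.

Section Independence.
Variables (K : fieldType) (phi : {rmorphism R -> K}).

Definition indep B := forall p, p \in invars B -> phi p = 0 -> p = 0.

(** The ring F[phi (x_ j) : j in B]. *)
Definition gen B : {pred K} :=
  [pred u | `[< exists2 p, p \in invars B & u = phi p >]].

Lemma gen_phi B p : p \in invars B -> phi p \in gen B.
Proof. by move=> pB; apply/asboolP; exists p. Qed.

Lemma gen_subring B : subring_closed (gen B).
Proof.
split=> [|_ _ /asboolP[p pB ->] /asboolP[q qB ->]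
         |_ _ /asboolP[p pB ->] /asboolP[q qB ->]]; apply/asboolP.
- by exists 1; rewrite ?rmorph1 ?rpred1.
- by exists (p - q); rewrite ?rmorphB ?rpredB.
- by exists (p * q); rewrite ?rmorphM ?rpredM.
Qed.

Lemma indep0 : indep finset.set0.
Proof.
move=> p /eqP p0 phip.
have [a pE] : exists a, p = c_ a.
  pose C : {pred R} := [pred q | `[< exists a, restr finset.set0 q = c_ a >]].
  suff /asboolP[a] : p \in C by rewrite p0 => ->; exists a.
  apply: (polynomial_ring_ind polR) => [|a|j].
  - split=> [|u v /asboolP[a ua] /asboolP[b vb]|u v /asboolP[a ua] /asboolP[b vb]].
    + by apply/asboolP; exists 1; rewrite !rmorph1.
    + by apply/asboolP; exists (a - b); rewrite !rmorphB ua vb.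
    + by apply/asboolP; exists (a * b); rewrite !rmorphM ua vb.
  - by apply/asboolP; exists a; rewrite restrC.
  - by apply/asboolP; exists 0; rewrite restrX inE rmorph0.
move/eqP: phip; rewrite pE (fmorph_eq0 (phi \o c_)) => /eqP ->.
exact: rmorph0.
Qed.

(** A relation that involves x_j is a polynomial in x_j whose coefficients are
    polynomials in B; they do not all vanish under phi, by independence of B. *)
Lemma dep_algebraic B j : j \notin B -> indep B -> ~ indep (j |: B) ->
  phi (x_ j) \in algebraic_over (gen B).
Proof.
move=> jB indB dep; apply: contrapT => nalg; apply: dep => p pB phip.
apply: contrapT => /eqP p0; apply: nalg; apply/asboolP.
exists (map_poly phi (slice j p)); split=> [e||].
- by rewrite coef_map; apply/gen_phi/slice_invars.
- apply: contra_neq p0 => sp0; rewrite -(horner_slice j p).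
  suff -> : slice j p = 0 by rewrite horner0.
  apply/polyP => e; rewrite coef0; apply: indB; first exact: slice_invars.
  by rewrite -coef_map sp0 coef0.
- by rewrite rootE horner_map horner_slice phip.
Qed.

Lemma lift_gen_poly B (p : {poly K}) : (forall e, p`_e \in gen B) ->
  exists2 G : {poly R}, forall e, G`_e \in invars B & map_poly phi G = p.
Proof.
move=> pB.
have /choice[q qP] : forall e, exists q, q \in invars B /\ p`_e = phi q.
  by move=> e; have /asboolP[q] := pB e; exists q.
exists (\poly_(e < size p) q e) => [e|].
  by rewrite coef_poly; case: ifP => _; [case: (qP e) | rewrite rpred0].
apply/polyP => e; rewrite coef_map coef_poly; case: ltnP => [_|jp].
  by case: (qP e).
by rewrite nth_default ?raddf0.
Qed.

Lemma algebraic_dep B j : j \notin B -> phi (x_ j) \in algebraic_over (gen B) ->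
  ~ indep (j |: B).
Proof.
move=> jB /asboolP[p [pB p0 pj]] ind.
have [G GB GE] := lift_gen_poly pB.
have sB : B \subset j |: B by apply: finset.subsetUr.
have Gj0 : G.[x_ j] = 0.
  apply: ind; last by rewrite -horner_map GE (rootP pj).
  rewrite horner_coef; apply: rpred_sum => e _; apply: rpredM.
    by apply: (invarsS sB); apply: GB.
  by apply: rpredX; apply: invarsX; rewrite !inE eqxx.
case/negP: p0; rewrite -GE; apply/eqP.
suff -> : G = 0 by rewrite raddf0.
have <- : slice j G.[x_ j] = G; last by rewrite Gj0 raddf0.
rewrite -horner_map /= sliceX eqxx.
have -> : map_poly (slice j) G = map_poly polyC G.
  by apply/polyP => e; rewrite !coef_map /=; apply: slice_polyC (GB e).
by rewrite -[RHS]comp_polyXr /comp_poly.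
Qed.

Lemma gen_min B (C : {pred K}) : subring_closed C ->
    (forall a, phi (c_ a) \in C) -> (forall j, j \in B -> phi (x_ j) \in C) ->
  {subset gen B <= C}.
Proof.
move=> Ccl CC CX _ /asboolP[p /eqP <- ->]; have [C1 CB CM] := Ccl.
apply: (polynomial_ring_ind polR (C := [pred q | phi (restr B q) \in C])).
- split=> [|u v|u v]; rewrite !inE ?rmorph1 // => uC vC.
    by rewrite !rmorphB; apply: CB.
  by rewrite !rmorphM; apply: CM.
- by move=> a; rewrite inE restrC.
- move=> j; rewrite inE restrX; case: ifP => [/CX //|_].
  by rewrite rmorph0 -(subrr 1); apply: CB.
Qed.

Lemma phi_min (C : {pred K}) : subring_closed C ->
    (forall a, phi (c_ a) \in C) -> (forall j, phi (x_ j) \in C) ->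
  forall p, phi p \in C.
Proof.
move=> Ccl CC CX p.
apply: (gen_min Ccl CC (B := [set: 'I_n])) => [i _|]; first exact: CX.
by apply: gen_phi; apply: invarsT.
Qed.

(** Elements algebraic over a subring form a field, so it is enough to look at the
    variables. *)
Lemma phi_algebraic B : (forall i, phi (x_ i) \in algebraic_over (gen B)) ->
  forall p, phi p \in algebraic_over (gen B).
Proof.
move=> algX; have genB := gen_subring B.
have [Ccl _] := algebraic_closed_subfield genB.
apply: (phi_min (divring_subring Ccl)) => // c.
by apply: subring_algebraic => //; apply: gen_phi; apply: invarsC.
Qed.

Lemma indepS B B' : B \subset B' -> indep B' -> indep B.
Proof. by move=> BB' ind p pB; apply/ind/(invarsS BB'). Qed.

End Independence.

Definition indep_mod P B := forall p, p \in invars B -> p \in P -> p = 0.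

Lemma indep_modE (K : fieldType) (phi : {rmorphism R -> K}) P B :
  (forall u, (phi u == 0) = (u \in P)) -> indep phi B <-> indep_mod P B.
Proof.
move=> phiP; split=> ind p pB pP; apply: ind => //.
  by apply/eqP; rewrite phiP.
by rewrite -phiP pP.
Qed.

Lemma max_algebraic (K : fieldType) (phi : {rmorphism R -> K}) B :
    indep phi B -> (forall j, j \notin B -> ~ indep phi (j |: B)) ->
  forall j, phi (x_ j) \in algebraic_over (gen phi B).
Proof.
move=> indB maxB j; have [jB|jB] := boolP (j \in B).
  by apply: subring_algebraic (gen_subring _ _) _ _; apply/gen_phi/invarsX.
exact: dep_algebraic (maxB j jB).
Qed.

(** If no variable could be added, everything would be algebraic over B modulo P.
    The constant term of a relation for g modulo P, once divided by a power of g,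
    is nonzero and belongs to P', which contains g; but B is independent modulo P'. *)
Lemma indep_up P P' g B : is_prime P -> is_prime P' -> {subset P <= P'} ->
    g \in P' -> g \notin P -> indep_mod P' B ->
  exists2 j, j \notin B & indep_mod P (j |: B).
Proof.
move=> [Pid Ppr] [[P'0 _ P'D] P'pr] PP' gP' gP indB'.
apply: contrapT => nex.
have [K [phi phiP]] := prime_field Pid Ppr.
have indB : indep phi B.
  by apply/(indep_modE _ phiP) => p pB /PP'; apply: indB'.
have algX := max_algebraic indB.
have {algX} /asboolP[p [pB p0 pg]] : phi g \in algebraic_over (gen phi B).
  apply: phi_algebraic; apply: algX => j jB indj; apply: nex.
  by exists j; [exact: jB|exact/(indep_modE _ phiP)].
have g0 : phi g != 0 by rewrite phiP.
have ex_e : exists e, p`_e != 0.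
  by exists (size p).-1; rewrite -lead_coefE lead_coef_eq0.
case: (ex_minnP ex_e) => e pe emin.
have pE : p = drop_poly e p * 'X^e.
  rewrite -[LHS](poly_take_drop e) [X in X + _](_ : _ = 0) ?add0r //.
  apply/polyP => i; rewrite coef_take_poly coef0; case: ltnP => // ie.
  by apply: contraTeq ie => /emin; rewrite -leqNgt.
have rg : root (drop_poly e p) (phi g).
  move: pg; rewrite pE rootM orbC /root hornerXn expf_eq0.
  by rewrite (negPf g0) andbF -pE.
have [|G GB GE] := @lift_gen_poly _ phi B (drop_poly e p).
  by move=> i; rewrite coef_drop_poly.
have GP : G.[g] \in P by rewrite -phiP -horner_map GE (rootP rg).
have G00 : G`_0 != 0.
  apply: contra_neq pe => G0.
  by have := congr1 (fun r : {poly K} => r`_0) GE;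
    rewrite coef_map G0 raddf0 coef_drop_poly add0n.
case/eqP: G00; apply: indB'; first exact: GB.
move: GP => /PP'; elim/poly_ind: (G) => [|H c _]; first by rewrite horner0 coef0.
rewrite hornerMXaddC coefD coefMX coefC !eqxx /= add0r => HP.
by rewrite -[c](addKr (H.[g] * g)) -mulNr; apply: P'D.
Qed.

(** Half of the equality between Krull dimension and transcendence degree: a chain
    of primes gives independent variables. *)
Lemma chain_indep (P : nat -> {pred R}) r :
    (forall i, (i <= r)%N -> is_prime (P i)) ->
    (forall i, (i < r)%N ->
       {subset P i <= P i.+1} /\ exists2 p, p \in P i.+1 & p \notin P i) ->
  exists2 B, indep_mod (P 0) B & #|B| = r.
Proof.
elim: r P => [|r IHr] P Ppr Pinc.
  exists finset.set0; last by rewrite cards0.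
  have [Pid P0pr] := Ppr 0%N isT; have [K [phi phiP]] := prime_field Pid P0pr.
  by apply/(indep_modE _ phiP)/indep0.
have [i lei|i lti|B indB cardB] := IHr (fun i => P i.+1).
- exact: Ppr.
- exact: Pinc.
have [sub01 [g gP1 gP0]] := Pinc 0%N isT.
have [j jB indj] := indep_up (Ppr 0%N isT) (Ppr 1%N isT) sub01 gP1 gP0 indB.
by exists (j |: B) => //; rewrite cardsU1 jB cardB.
Qed.

Lemma extend_indep P B : indep_mod P B ->
  exists B', [/\ B \subset B', indep_mod P B'
               & forall j, j \notin B' -> ~ indep_mod P (j |: B')].
Proof.
have [m] := ubnP (n - #|B|); elim: m => // m IHm in B * => lem indB.
have [maxB|] := pselect (forall j, j \notin B -> ~ indep_mod P (j |: B)).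
  by exists B.
move=> /existsNP[j /not_implyP[jB /contrapT indj]].
have cardj : #|j |: B| = #|B|.+1 by rewrite cardsU1 jB.
have [|B' [jBB' indB' maxB']] := IHm (j |: B) _ indj.
  have : (#|j |: B| <= n)%N by rewrite -[X in (_ <= X)%N]card_ord max_card.
  rewrite cardj => ltn; rewrite -ltnS (leq_trans _ lem) // ltnS.
  by rewrite subnS prednK // subn_gt0.
by exists B'; split=> //; apply: fintype.subset_trans jBB'; apply: finset.subsetUr.
Qed.

Section Step.
Variables (K : fieldType) (phi : {rmorphism R -> K}).
Variables (B : {set 'I_n}) (b : 'I_n).
Hypotheses (bB : b \in B) (indB : indep phi B).

(** Integrality of phi over gen B localized at c. *)
Definition integral_off c := forall p, exists r : {poly K},
  [/\ r \is monic, root r (phi p) &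
    forall i, exists m w, w \in invars B /\ r`_i * phi c ^+ m = phi w].

(** The witness is the product of the leading coefficients of polynomials that
    vanish at the variables: outside its zeros these polynomials can be made monic. *)
Lemma common_denominator :
    (forall j, phi (x_ j) \in algebraic_over (gen phi B)) ->
  exists c, [/\ c \in invars B, c != 0 & integral_off c].
Proof.
move=> algX; have genB := gen_subring phi B.
have phi0 w : w \in invars B -> w != 0 -> phi w != 0.
  by move=> wB; apply: contra_neq; apply: indB.
have /choice[r rP] : forall j, exists r : {poly K},
    [/\ forall i, r`_i \in gen phi B, r != 0 & root r (phi (x_ j))].
  by move=> j; apply/asboolP/algX.
have /choice[l lP] : forall j, exists l,
    [/\ l \in invars B, l != 0 & phi l = lead_coef (r j)].
  move=> j; have [rB r0 _] := rP j.
  have /asboolP[l lB lE] := rB (size (r j)).-1; exists l; split=> //.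
  apply/eqP => l0; move: r0; rewrite -lead_coef_eq0 lead_coefE lE l0.
  by rewrite raddf0 eqxx.
pose c := \prod_j l j.
have cB : c \in invars B by apply: rpred_prod => j _; case: (lP j).
have c0 : c != 0 by apply/prodf_neq0 => j _; case: (lP j).
pose A1 : {pred K} := [pred u | `[< exists m w, w \in invars B /\
  u * phi c ^+ m = phi w >]].
have A1gen w : w \in invars B -> phi w \in A1.
  by move=> wB; apply/asboolP; exists 0%N, w; rewrite expr0 mulr1.
have A1cl : subring_closed A1.
  split.
  - by rewrite -(rmorph1 phi); apply/A1gen/rpred1.
  - move=> u v /asboolP[m [w [wB uE]]] /asboolP[m' [w' [wB' vE]]].
    apply/asboolP; exists (m + m')%N, (w * c ^+ m' - w' * c ^+ m); split.
      by apply: rpredB; apply: rpredM => //; apply: rpredX.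
    by rewrite rmorphB !rmorphM !rmorphXn /= -uE -vE exprD; ring.
  - move=> u v /asboolP[m [w [wB uE]]] /asboolP[m' [w' [wB' vE]]].
    apply/asboolP; exists (m + m')%N, (w * w'); split; first exact: rpredM.
    by rewrite rmorphM /= -uE -vE exprD; ring.
have [A [i iP]] := subring_image A1cl.
have intA1 u : u \in A1 -> integralOver i u.
  by move=> /iP[a <-]; apply: integral_id.
have intX j : integralOver i (phi (x_ j)).
  have [rB r0 rj] := rP j; have [lB l0 lE] := lP j.
  have l0' : lead_coef (r j) != 0 by rewrite lead_coef_eq0.
  apply: (@integral_root_monic _ _ i _ ((lead_coef (r j))^-1 *: r j)).
  - by rewrite monicE lead_coefZ mulVf.
  - by rewrite rootE hornerZ (rootP rj) mulr0.
  apply/(integral_poly i) => e; apply: intA1; apply/asboolP.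
  have /asboolP[w wB wE] := rB e.
  exists 1%N, (w * \prod_(k < n | k != j) l k); split.
    by apply: rpredM => //; apply: rpred_prod => k _; case: (lP k).
  rewrite coefZ expr1 /c (bigD1 j) //= !rmorphM wE /= lE.
  by field.
pose C : {pred K} := [pred u | `[< integralOver i u >]].
have Ccl : subring_closed C.
  split=> [|u v /asboolP ui /asboolP vi|u v /asboolP ui /asboolP vi].
  - by apply/asboolP; apply: integral1.
  - by apply/asboolP; apply: integral_sub.
  - by apply/asboolP; apply: integral_mul.
exists c; split=> // p.
have /asboolP[s smon sroot] : phi p \in C.
  apply: (phi_min Ccl) => [d|j]; apply/asboolP => //.
  by apply/intA1/A1gen/invarsC.
exists (map_poly i s); split=> //.
- exact: monic_map.
- by move=> e; rewrite coef_map; apply/asboolP/iP; exists s`_e.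
Qed.

(** The element a = 1 + x_b c is coprime to c and not constant in x_b. If s is
    constant in x_b and divisible by a in the image of phi, the quotient t is
    integral away from c, so a divides a power of s up to a power of c, hence
    divides a power of s, which is impossible by degree in x_b. So a stays
    noninvertible after inverting the polynomials in the variables B minus b. *)
Lemma coprime_denominator c : c \in invars B -> c != 0 -> integral_off c ->
  let a := 1 + x_ b * c in
  forall s t, s \in invars (B :\ b) -> s != 0 -> phi s <> phi t * phi a.
Proof.
move=> cB c0 intc a s t sB' s0 st.
have bB' : b \notin B :\ b by rewrite !inE eqxx.
have xB : x_ b \in invars B by apply: invarsX.
have sB : s \in invars B by apply: invarsS sB'; apply: subD1set.
have aB : a \in invars B by apply: rpredD; [apply: rpred1|apply: rpredM].
have phic0 : phi c != 0 by apply: contra_neq c0; apply: indB.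
have [r [rmon rt rB]] := intc t.
pose e := (size r).-1.
have /choice[m /choice[w mwP]] := rB.
pose M := (\sum_(i < e) m i)%N.
(* the monic equation of t, multiplied by a ^ e * c ^ M, reads s ^ e * c ^ M
   modulo a, because s = t * a *)
have [v vB vE] : exists2 v, v \in invars B & c ^+ M * s ^+ e = a * v.
  pose v := - \sum_(i < e) w i * c ^+ (M - m i) * s ^+ i * a ^+ (e - i.+1).
  have vB : v \in invars B.
    rewrite /v rpredN; apply: rpred_sum => i _.
    by do !apply: rpredM; try apply: rpredX => //; case: (mwP i).
  exists v => //; apply/eqP; rewrite -subr_eq0; apply/eqP; apply: indB.
    by apply: rpredB; apply: rpredM => //; apply: rpredX.
  rewrite rmorphB !rmorphM !rmorphXn rmorphN rmorph_sum /= mulrN opprK.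
  have := rootP rt; rewrite horner_coef (polySpred (monic_neq0 rmon)) -/e.
  rewrite big_ord_recr /= -lead_coefE (monicP rmon) mul1r => rt0.
  rewrite st exprMn [X in X + _](_ : _ = phi c ^+ M * phi a ^+ e * phi t ^+ e);
    last by ring.
  rewrite mulr_sumr [X in _ + X](_ : _ =
      phi c ^+ M * phi a ^+ e * \sum_(i < e) r`_i * phi t ^+ i).
    by rewrite -mulrDr addrC rt0 mulr0.
  rewrite mulr_sumr; apply: eq_bigr => i _.
  have [_ wi] := mwP i.
  have leM : (m i <= M)%N by rewrite /M (bigD1 i) //= leq_addr.
  rewrite !rmorphM !rmorphXn /= -wi st exprMn.
  have -> : phi c ^+ M = phi c ^+ (M - m i) * phi c ^+ m i.
    by rewrite -exprD subnK.
  have -> : phi a ^+ e = phi a ^+ (e - i.+1) * phi a ^+ i * phi a.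
    by rewrite -mulrA -exprSr -exprD subnK.
  by ring.
(* x_b * c = -1 modulo a, so the power of c can be removed *)
have [u uE] : exists u, s ^+ e = a * u.
  have [h hE] : exists h, (a - 1) ^+ M = (-1) ^+ M + a * h.
    elim: (M) => [|k [h hE]]; first by exists 0; rewrite mulr0 addr0 !expr0.
    exists ((-1) ^+ k + a * h - h); rewrite !exprS hE; ring.
  exists ((-1) ^+ M * (x_ b ^+ M * v - h * s ^+ e)).
  have : x_ b ^+ M * (c ^+ M * s ^+ e) = a * (x_ b ^+ M * v).
    by rewrite vE; ring.
  rewrite mulrA -exprMn [x_ b * c](_ : _ = a - 1); last by rewrite /a; ring.
  rewrite hE => H.
  have : (-1) ^+ M * (-1) ^+ M = 1 :> R.
    by rewrite -exprD addnn -mul2n exprM sqrrN !expr1n.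
  move=> sgn; rewrite [LHS](_ : _ = (-1) ^+ M * ((-1) ^+ M * s ^+ e)); last first.
    by rewrite mulrA sgn mul1r.
  rewrite [(-1) ^+ M * s ^+ e](_ : _ = ((-1) ^+ M + a * h) * s ^+ e -
    a * h * s ^+ e); last by ring.
  by rewrite H; ring.
(* s is constant in x_b, but a is not *)
have sc0 : slice b c != 0.
  by apply: contra_neq c0 => sc; rewrite -(horner_slice b c) sc horner0.
have sza : (1 < size (slice b a))%N.
  rewrite /a rmorphD rmorphM rmorph1 /= sliceX eqxx addrC mulrC.
  have -> : 1 = 1%:P :> {poly R} by [].
  by rewrite size_MXaddC (negPf sc0) ltnS size_poly_gt0.
have := congr1 (fun q => size (slice b q)) uE.
rewrite rmorphXn rmorphM /= (slice_polyC bB' sB') -polyC_exp size_polyC.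
rewrite expf_neq0 //.
have [->|u0] := eqVneq (slice b u) 0; first by rewrite mulr0 size_poly0.
rewrite size_mul //; last by rewrite -size_poly_gt0 ltnW.
move: sza; rewrite -size_poly_gt0 in u0; case: (size _) => [|[|k]] // _.
by move: u0; case: (size _) => // l _; rewrite addnS.
Qed.

End Step.

(** The prime is chosen to contain the element a of coprime_denominator and to avoid
    all nonzero polynomials in the other variables of B. *)
Lemma prime_above Q B b : is_prime Q -> indep_mod Q B ->
    (forall j, j \notin B -> ~ indep_mod Q (j |: B)) -> b \in B ->
  exists Q', [/\ is_prime Q', {subset Q <= Q'},
    exists2 p, p \in Q' & p \notin Q & indep_mod Q' (B :\ b)].
Proof.
move=> [Qid Qpr] indBQ maxB bB; have [K [phi phiP]] := prime_field Qid Qpr.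
have indB : indep phi B by apply/(indep_modE _ phiP).
have algX : forall j, phi (x_ j) \in algebraic_over (gen phi B).
  by apply: max_algebraic => // j jB indj; apply: (maxB j jB);
    apply/(indep_modE _ phiP).
have [c [cB c0 intc]] := common_denominator indB algX.
pose a := 1 + x_ b * c.
pose I u := exists t q, q \in Q /\ u = t * a + q.
pose S s := s \in invars (B :\ b) /\ s != 0.
have [Q0 Q1 QD] := Qid.
have [||||u [t [q [qQ ->]]] [sB s0]|P [Pid Ppr IP SP]] :=
    @prime_avoiding R I S.
- by exists 0, 0; rewrite mul0r addr0.
- move=> v u w [t [q [qQ ->]]] [t' [q' [qQ' ->]]].
  exists (v * t + t'), (v * q + q'); split; first exact: QD.
  by ring.
- by split; [apply: rpred1|apply: oner_neq0].
- move=> u v [uB u0] [vB v0].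
  by split; [apply: rpredM|rewrite mulf_neq0].
- have := coprime_denominator bB indB cB c0 intc (t := t) sB s0.
  case; rewrite rmorphD rmorphM /=.
  by move: qQ; rewrite -phiP => /eqP ->; rewrite addr0.
have sP u : u \in invars (B :\ b) -> u \in P -> u = 0.
  move=> uB uP; apply/eqP; apply: contraTT uP => u0; exact: SP.
exists P; split=> //.
- by move=> q qQ; apply: IP; exists 0, q; rewrite mul0r add0r.
exists a.
  by apply: IP; exists 1, 0; rewrite mul1r addr0.
rewrite -phiP; apply/negP => /eqP a0.
have {}a0 : a = 0.
  apply: indB a0; apply: rpredD; first exact: rpred1.
  by apply: rpredM => //; apply: invarsX.
have := congr1 (fun q => (slice b q).[0]) a0.
rewrite rmorph0 rmorphD rmorph1 rmorphM /= sliceX eqxx !hornerE => /eqP.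
by rewrite ?mul0r ?addr0 oner_eq0.
Qed.

(** The other half: independent variables give a chain of primes, as going up by
    prime_above loses only one of them. *)
Lemma chain_above r Q B : is_prime Q -> indep_mod Q B -> (r <= #|B|)%N ->
  exists P : nat -> {pred R},
    [/\ P 0 = Q, forall i, (i <= r)%N -> is_prime (P i) &
      forall i, (i < r)%N ->
        {subset P i <= P i.+1} /\ exists2 p, p \in P i.+1 & p \notin P i].
Proof.
elim: r Q B => [|r IHr] Q B Qpr indB lerB; first by exists (fun=> Q).
have [B' [BB' indB' maxB']] := extend_indep indB.
have lerB' : (r < #|B'|)%N by apply: leq_trans lerB (subset_leq_card BB').
have [b bB'] : exists b, b \in B'.
  by apply/card_gt0P; apply: leq_ltn_trans lerB'.
have [Q' [Q'pr QQ' Q'Q indQ']] := prime_above Qpr indB' maxB' bB'.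
have [|P [P0 Ppr Pinc]] := IHr Q' (B' :\ b) Q'pr indQ'.
  by rewrite (cardsD1 b) bB' in lerB'.
exists (fun i => if i is i'.+1 then P i' else Q); split=> // -[|i] //.
- exact: Ppr.
- by rewrite P0.
- exact: Pinc.
Qed.

Section TranscendenceBound.
Variables (K : fieldType) (phi : {rmorphism R -> K}).

Definition constants : {pred K} := [pred u | `[< exists a, u = phi (c_ a) >]].

(** A member of B which depends on the earlier ones would give a relation in B. *)
Lemma indep_bound B (us : seq K) : indep phi B ->
    (forall j, phi (x_ j) \in rcl (adjoins constants us)) ->
  (#|B| <= size us)%N.
Proof.
move=> indB xus; rewrite leqNgt; apply/negP => lt_us_B.
pose js := enum B; pose zs := [seq phi (x_ j) | j <- js].
have szzs : size zs = #|B| by rewrite size_map -cardE.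
have [||i lti zi] := @steinitz _ constants us zs; last 1 first.
- have [j0 _] : exists j, j \in B.
    by apply/card_gt0P; apply: leq_ltn_trans lt_us_B.
  have ltijs : (i < size js)%N by rewrite -cardE -szzs.
  pose j := nth j0 js i; pose B1 := [set l in take i js].
  have jB1 : j \notin B1.
    rewrite inE; have : uniq js := enum_uniq _.
    rewrite -[X in uniq X](cat_take_drop i) (drop_nth j0 ltijs) cat_uniq /=.
    by case/and3P => _; rewrite negb_or => /andP[].
  have jB1B : j |: B1 \subset B.
    apply/fintype.subsetP => l; rewrite !inE => /orP[/eqP->|/mem_take].
      by rewrite -mem_enum mem_nth.
    by rewrite mem_enum.
  apply: (algebraic_dep jB1) (indepS jB1B indB).
  have genB1 := gen_subring phi B1.
  move: zi; rewrite (nth_map j0) // => zi.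
  apply: rcl_min (algebraic_closed_subfield genB1) _ _ zi => u.
  rewrite inE => /orP[/asboolP[a ->]|].
    by apply: subring_algebraic => //; apply/gen_phi/invarsC.
  rewrite -map_take => /mapP[l ljs ->].
  by apply: subring_algebraic => //; apply/gen_phi/invarsX; rewrite inE.
- by move=> _ /mapP[j _ ->]; apply: xus.
- by rewrite szzs.
Qed.

End TranscendenceBound.

End PolynomialRings.

(** * Krull dimension *)

Section MPoly.
Variables (F : comNzRingType) (n : nat).

Lemma mpoly_polynomial_ring :
  polynomial_ring (@mpolyC n F : {rmorphism F -> {mpoly F[n]}})
    (fun j => @mpolyX n F (mnm1 j)).
Proof.
split=> [S f y|C Ccl CC CX p].
  exists (mmap f y : {rmorphism {mpoly F[n]} -> S}).
  by split=> [a|j]; rewrite /= ?mmapC // mmapX mmap1U.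
pose C' : subringClosed {mpoly F[n]} :=
  HB.pack C (GRing.isSubringClosed.Build {mpoly F[n]} C Ccl).
rewrite (mpolyE p); apply: (@rpred_sum _ C') => m _.
rewrite -mul_mpolyC; apply: (@rpredM _ C'); first exact: CC.
rewrite mpolyXE_id; apply: (@rpred_prod _ C') => j _.
by apply: (@rpredX _ C'); apply: CX.
Qed.

End MPoly.

Section KrullDimension.
Variables (F : fieldType) (n : nat).
Implicit Types (S : set {mpoly F[n]}).
Local Open Scope ereal_scope.

Lemma krull_dim_le S (M : \bar int) :
  (forall r, prime_chain S r -> (r%:Z%:E <= M)) -> krull_dim S <= M.
Proof.
move=> chM; rewrite /krull_dim /supremum; case: ifP => _; first exact: leNye.
case: xgetP => [y _ [_ ymin]|_]; last exact: leNye.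
by apply: ymin => _ [r Sr <-]; apply: chM.
Qed.

(** The supremum over chains is taken in the extended integers: it is attained if
    the lengths are bounded and it is the top element if not. *)
Lemma prime_chain_le S r : prime_chain S r -> r%:Z%:E <= krull_dim S.
Proof.
move=> Sr; apply: ge_supremum_Nmem; last by exists r.
set A := [set _ | _ in _]%classic.
have [[N AN]|unb] := pselect (exists N, forall s, prime_chain S s -> (s <= N)%N).
  have [|N0 [ubN0 minN0]] := @nat_supremums_neq0 (prime_chain S).
    by exists N => s Ss; apply: AN.
  have N0S : prime_chain S N0.
    apply: contrapT => nS; case: N0 ubN0 minN0 nS => [|N0] ubN0 minN0 nS.
      have r0 := ubN0 r Sr.
      by apply: nS; move: r0; rewrite leEnat leqn0 => /eqP <-.
    have : (N0.+1 <= N0)%N; last by rewrite ltnn.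
    apply: minN0 => s Ss; have := ubN0 _ Ss.
    rewrite !leEnat leq_eqVlt => /orP[/eqP sN0|//].
    by case: nS; rewrite -sN0.
  exists N0%:Z%:E; split=> [_ [s Ss <-]|b ubb]; last by apply: ubb; exists N0.
  by rewrite lee_fin lez_nat; apply: ubN0.
exists +oo; split=> [_ [s _ <-]|[b||] ubb //]; first exact: leey.
  exfalso; apply: unb; exists `|b|%N => s Ss.
  have : s%:Z%:E <= b%:E by apply: ubb; exists s.
  by rewrite lee_fin; case: b {ubb} => b; rewrite ?lez_nat.
have : r%:Z%:E <= -oo by apply: ubb; exists r.
by rewrite leeNy_eq.
Qed.

End KrullDimension.

(** * Power series and algebraic dependence *)

Section PowerSeries.
Variable K : fieldType.
Implicit Types (f g : fps K) (p : {poly K}) (l : nat).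

Lemma fps_coefD f g l : (f + g) l = f l + g l. Proof. by []. Qed.
Lemma fps_coefN f l : (- f) l = - f l. Proof. by []. Qed.
Lemma fps_coef0 l : (0 : fps K) l = 0. Proof. by []. Qed.
Lemma fps_coef1 l : (1 : fps K) l = (l == 0%N)%:R. Proof. by []. Qed.
Lemma fps_coefM f g l : (f * g) l = \sum_(j < l.+1) f j * g (l - j)%N.
Proof. by []. Qed.

Lemma fps_coef_sum (I : Type) (s : seq I) (P : pred I) (F : I -> fps K) l :
  (\sum_(i <- s | P i) F i) l = \sum_(i <- s | P i) F i l.
Proof. by elim/big_rec2: _ => // i _ f _ <-. Qed.

Fact fps_of_poly_zmod : zmod_morphism (@fps_of_poly K).
Proof. by move=> p q; apply: fpsP => l; rewrite /= coefB. Qed.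
Fact fps_of_poly_monoid : monoid_morphism (@fps_of_poly K).
Proof.
split=> [|p q]; apply: fpsP => l; first by rewrite /= coef1.
by rewrite /= coefM.
Qed.
HB.instance Definition _ := GRing.isZmodMorphism.Build {poly K} (fps K)
  (@fps_of_poly K) fps_of_poly_zmod.
HB.instance Definition _ := GRing.isMonoidMorphism.Build {poly K} (fps K)
  (@fps_of_poly K) fps_of_poly_monoid.

Lemma fps_of_poly_inj : injective (@fps_of_poly K).
Proof.
by move=> p q pq; apply/polyP => l; have := congr1 (fun f : fps K => f l) pq.
Qed.

Lemma coef_fps_CM (a : K) f l : (fps_of_poly a%:P * f) l = a * f l.
Proof.
rewrite fps_coefM big_ord_recl /= coefC /= subn0 big1 ?addr0 // => j _.
by rewrite coefC /= mul0r.
Qed.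

Lemma coef_fps_XnM e f l :
  (fps_of_poly 'X^e * f) l = if (l < e)%N then 0 else f (l - e)%N.
Proof.
rewrite fps_coefM; case: ltnP => [le|el].
  apply: big1 => j _; rewrite /= coefXn.
  by rewrite (_ : (j == e :> nat) = false) ?mul0r //; apply: ltn_eqF;
    apply: leq_ltn_trans le; rewrite -ltnS.
have lte : (e < l.+1)%N by [].
rewrite (bigD1 (Ordinal lte)) //= coefXn eqxx mul1r big1 ?addr0 // => j.
by rewrite -val_eqE /= coefXn => /negPf ->; rewrite mul0r.
Qed.

Definition fps_ev0 f : K := f 0%N.
Fact fps_ev0_zmod : zmod_morphism fps_ev0. Proof. by []. Qed.
Fact fps_ev0_monoid : monoid_morphism fps_ev0.
Proof. by split=> // f g; rewrite /fps_ev0 fps_coefM big_ord1. Qed.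
HB.instance Definition _ := GRing.isZmodMorphism.Build (fps K) K
  fps_ev0 fps_ev0_zmod.
HB.instance Definition _ := GRing.isMonoidMorphism.Build (fps K) K
  fps_ev0 fps_ev0_monoid.

Definition fps_over (C : {pred K}) : {pred fps K} :=
  [pred f : fps K | `[< forall l, f l \in C >]].

Lemma fps_overP C f : reflect (forall l, f l \in C) (f \in fps_over C).
Proof. exact: asboolP. Qed.

Lemma fps_over_subring C : subring_closed C -> subring_closed (fps_over C).
Proof.
move=> Ccl.
pose C' : subringClosed K := HB.pack C (GRing.isSubringClosed.Build K C Ccl).
split=> [|f g /fps_overP fC /fps_overP gC|f g /fps_overP fC /fps_overP gC];
  apply/fps_overP => l.
- by rewrite fps_coef1; apply: (@rpred_nat _ C').
- by rewrite fps_coefD fps_coefN; apply: (@rpredB _ C').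
- rewrite fps_coefM; apply: (@rpred_sum _ C') => j _.
  exact: (@rpredM _ C').
Qed.

(** After division by a power of x the polynomial is nonzero modulo x, and the
    constant term of f is a root of this reduction. *)
Lemma root_ev0 C f (P : {poly fps K}) : {subset algebraic_over C <= C} ->
    (forall i, P`_i \in fps_over C) -> P != 0 -> P.[f] = 0 -> f 0%N \in C.
Proof.
move=> Calg PC P0 Pf.
have ex_l : exists l, [exists i : 'I_(size P), P`_i l != 0].
  apply: contrapT => nex; case/eqP: P0; apply/polyP => i; apply: fpsP => l.
  rewrite coef0 fps_coef0; have [ltiP|] := ltnP i (size P); last first.
    by move=> le; rewrite nth_default.
  apply: contrapT => /eqP Pil; apply: nex; exists l; apply/existsP.
  by exists (Ordinal ltiP).
case: (ex_minnP ex_l) => l /existsP[i Pil] lmin.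
pose Q := \poly_(j < size P) (Fps (fun t => P`_j (t + l)%N)).
have QE j : Q`_j = Fps (fun t => P`_j (t + l)%N).
  rewrite coef_poly; case: ltnP => // le; rewrite nth_default //.
have PQ : P = (fps_of_poly 'X^l)%:P * Q.
  apply/polyP => j; rewrite coefCM; apply: fpsP => t.
  rewrite coef_fps_XnM QE; case: ltnP => [ltl|lel]; last by rewrite /= subnK.
  have [ltjP|le] := ltnP j (size P); last by rewrite nth_default.
  apply: contrapT => /eqP Pjt.
  have /lmin : [exists i : 'I_(size P), P`_i t != 0].
    by apply/existsP; exists (Ordinal ltjP).
  by rewrite leqNgt ltl.
have X0 : fps_of_poly 'X^l != 0 :> fps K.
  rewrite -(rmorph0 (@fps_of_poly K)) (inj_eq fps_of_poly_inj).
  by rewrite expf_neq0 // polyX_eq0.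
have Qf : Q.[f] = 0.
  move: Pf; rewrite PQ hornerM hornerC => /eqP.
  by rewrite mulf_eq0 (negPf X0) /= => /eqP.
apply: Calg; apply/asboolP; exists (map_poly fps_ev0 Q); split=> [j||].
- by rewrite coef_map QE; have /fps_overP := PC j; apply.
- apply: contra_neq Pil => Q0; have := congr1 (fun q : {poly K} => q`_i) Q0.
  by rewrite coef_map QE coef0.
- by rewrite rootE (horner_map fps_ev0 Q f) Qf rmorph0.
Qed.

(** The constant term of f is in C by root_ev0; with f = f(0) + x g, the series g is
    a root of the polynomial P(f(0) + x T), so the next coefficients follow. *)
Lemma root_fps_over C f (P : {poly fps K}) : closed_subfield C ->
    (forall i, P`_i \in fps_over C) -> P != 0 -> P.[f] = 0 ->
  f \in fps_over C.
Proof.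
move=> [Ccl Calg] PC P0 Pf; apply/fps_overP => l.
have CS := divring_subring Ccl.
pose C' : subringClosed K := HB.pack C (GRing.isSubringClosed.Build K C CS).
pose S : subringClosed (fps K) := HB.pack (fps_over C)
  (GRing.isSubringClosed.Build (fps K) (fps_over C) (fps_over_subring CS)).
elim: l f P PC P0 Pf => [|l IHl] f P PC P0 Pf; first exact: root_ev0 P0 Pf.
have f0C := root_ev0 Calg PC P0 Pf.
pose x : fps K := fps_of_poly 'X; pose c : fps K := fps_of_poly (f 0%N)%:P.
have xS : x \in S.
  by apply/fps_overP => t; rewrite /= coefX; apply: (@rpred_nat _ C').
have cS : c \in S.
  apply/fps_overP => t; rewrite /= coefC; case: ifP => // _.
  exact: (@rpred0 _ C').
pose g : fps K := Fps (fun t => f t.+1).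
have fE : f = x * g + c.
  apply: fpsP => -[|t]; rewrite fps_coefD /x -['X]expr1 coef_fps_XnM /=.
    by rewrite coefC add0r.
  by rewrite subn1 /= coefC addr0.
have x0 : x != 0.
  rewrite -(rmorph0 (@fps_of_poly K)) (inj_eq fps_of_poly_inj).
  by rewrite polyX_eq0.
have sz2 : size (x%:P * 'X + c%:P) = 2.
  by rewrite size_MXaddC polyC_eq0 (negPf x0) size_polyC x0.
apply: (IHl g (P \Po (x%:P * 'X + c%:P))).
- move=> i; apply: (polyOverP (S := S)); apply: polyOver_comp.
    by apply/polyOverP.
  by rewrite rpredD ?rpredM ?polyOverX ?polyOverC.
- by rewrite comp_poly2_eq0.
- by rewrite horner_comp !hornerE -fE.
Qed.

End PowerSeries.

Section Transfer.
Variables (k K : fieldType) (A : pointedType) (ev : {rmorphism (A -> k) -> K}).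

(** A family of series indexed by A gives a series over K, coefficient by
    coefficient; identities between the members pass to the image. *)
Definition fps_transfer (f : A -> fps k) : fps K :=
  Fps (fun l => ev (fun v => f v l)).

Fact fps_transfer_zmod : zmod_morphism fps_transfer.
Proof. by move=> f g; apply: fpsP => l /=; rewrite -rmorphB. Qed.
Fact fps_transfer_monoid : monoid_morphism fps_transfer.
Proof.
split=> [|f g]; apply: fpsP => l.
  rewrite fps_coef1 /= -(rmorph_nat ev); congr (ev _).
  apply/funext => v.
  change ((l == 0%N)%:R = ((l == 0%N)%:R : A -> k) v); by case: (l == 0%N).
rewrite fps_coefM /=.
under eq_bigr do rewrite -rmorphM.
rewrite -rmorph_sum; congr (ev _); apply/funext => v.
by rewrite fct_sumE.
Qed.
HB.instance Definition _ := GRing.isZmodMorphism.Build (A -> fps k) (fps K)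
  fps_transfer fps_transfer_zmod.
HB.instance Definition _ := GRing.isMonoidMorphism.Build (A -> fps k) (fps K)
  fps_transfer fps_transfer_monoid.

Definition poly2_transfer (a b : nat) (Q : A -> {poly {poly k}}) : {poly {poly K}} :=
  \poly_(j < a) \poly_(i < b) ev (fun v => (Q v)`_j`_i).

Lemma coef_sizeY (F : fieldType) (Q : {poly {poly F}}) b i j :
  (sizeY Q <= b)%N -> (b <= i)%N -> Q`_j`_i = 0.
Proof.
by move=> szQ bi; rewrite -coef_swapXY [_`_i]nth_default ?coef0 // -sizeYE
  (leq_trans szQ).
Qed.

Lemma coef_poly2_transfer a b (Q : A -> {poly {poly k}}) i j :
    (forall v, (size (Q v) <= a)%N) -> (forall v, (sizeY (Q v) <= b)%N) ->
  (poly2_transfer a b Q)`_j`_i = ev (fun v => (Q v)`_j`_i).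
Proof.
move=> Qa Qb; rewrite coef_poly; case: ltnP => [_|aj].
  rewrite coef_poly; case: ltnP => // bi.
  rewrite (_ : (fun v => _) = 0) ?rmorph0 //.
  by apply/funext => v; rewrite (coef_sizeY _ (Qb v)).
rewrite coef0 (_ : (fun v => _) = 0) ?rmorph0 //.
by apply/funext => v; rewrite [(Q v)`_j]nth_default ?coef0 ?(leq_trans (Qa v)).
Qed.

Lemma eval_xT_transfer a b (Q : A -> {poly {poly k}}) (f : A -> fps k) :
    (forall v, (size (Q v) <= a)%N) -> (forall v, (sizeY (Q v) <= b)%N) ->
  eval_xT (poly2_transfer a b Q) (fps_transfer f) =
  fps_transfer (fun v => eval_xT (Q v) (f v)).
Proof.
move=> Qa Qb; rewrite /eval_xT (@horner_coef_wide _ a); last first.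
  by rewrite (leq_trans (size_poly _ _)) ?size_poly.
have -> : (fun v => (map_poly (@fps_of_poly k) (Q v)).[f v]) =
    \sum_(j < a) (fun v => fps_of_poly (Q v)`_j) * f ^+ j.
  apply/funext => v; rewrite fct_sumE (@horner_coef_wide _ a).
    by apply: eq_bigr => j _; rewrite coef_map exprfctE.
  by rewrite (leq_trans (size_poly _ _)).
rewrite rmorph_sum; apply: eq_bigr => j _; rewrite rmorphM rmorphXn coef_map.
congr (_ * _); apply: fpsP => i /=.
exact: coef_poly2_transfer.
Qed.

End Transfer.

(** * Minimal polynomials and the order of their values *)

Section MinimalPolynomials.
Variable k : fieldType.
Implicit Types (f g : fps k) (P Q R : {poly {poly k}}) (p : {poly k}).

Lemma eval_xTD P Q g : eval_xT (P + Q) g = eval_xT P g + eval_xT Q g.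
Proof. by rewrite /eval_xT rmorphD hornerD. Qed.

Lemma eval_xTM P Q g : eval_xT (P * Q) g = eval_xT P g * eval_xT Q g.
Proof. by rewrite /eval_xT rmorphM hornerM. Qed.

Lemma eval_xTC p g : eval_xT p%:P g = fps_of_poly p.
Proof. by rewrite /eval_xT map_polyC hornerC. Qed.

Lemma eval_xTXn n g : eval_xT 'X^n g = g ^+ n.
Proof. by rewrite /eval_xT map_polyXn hornerXn. Qed.

Lemma eval_xT_sum (I : Type) (s : seq I) (F : I -> {poly {poly k}}) g :
  eval_xT (\sum_(i <- s) F i) g = \sum_(i <- s) eval_xT (F i) g.
Proof. by rewrite /eval_xT rmorph_sum horner_sum. Qed.

Lemma fps_of_poly_eq0 p : (fps_of_poly p == 0) = (p == 0).
Proof.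
by rewrite -(rmorph0 (@fps_of_poly k)) (inj_eq (@fps_of_poly_inj k)).
Qed.

Lemma size_det n (A : 'M[{poly k}]_n) b : (forall i j, (size (A i j) <= b)%N) ->
  (size (\det A) <= (n * b).+1)%N.
Proof.
move=> Ab; apply: leq_trans (size_sum _ _ _) _; apply/bigmax_leqP => s _.
rewrite mulr_sign (fun_if (fun p : {poly k} => size p)) size_polyN if_same.
apply: leq_trans (size_prod_leq _ _) _.
apply: leq_trans (leq_subr _ _) _; rewrite ltnS.
apply: leq_trans (leq_sum _ (fun i _ => Ab i _)) _.
by rewrite sum_nat_const card_ord.
Qed.

Lemma size_coef_sizeY Q b j : (sizeY Q <= b)%N -> (size (Q`_j)%R <= b)%N.
Proof.
by move=> Qb; apply/leq_sizeP => i bi; apply: coef_sizeY bi.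
Qed.

Lemma sizeY_leq Q s : (forall j, (size (Q`_j)%R <= s)%N) -> (sizeY Q <= s)%N.
Proof.
move=> Qs; rewrite sizeYE; apply/leq_sizeP => i si; apply/polyP => j.
by rewrite coef_swapXY coef0 nth_default // (leq_trans (Qs j)).
Qed.

Lemma size_resultant P Q a b :
    (size P <= a)%N -> (size Q <= a)%N -> (sizeY P <= b)%N -> (sizeY Q <= b)%N ->
  (size (resultant P Q) <= (2 * a * b).+1)%N.
Proof.
move=> Pa Qa Pb Qb; apply: leq_trans (size_det (b := b) _) _ => [i j|].
  rewrite Sylvester_mxE /=; case: (fintype.split i) => l; case: (l <= j)%N;
    by rewrite ?mulr1n ?mulr0n ?size_poly0 //; apply: size_coef_sizeY.
rewrite ltnS leq_mul2r mul2n -addnn.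
by rewrite leq_add ?orbT // (leq_trans (leq_pred _)).
Qed.

(** The resultant of P and Q is a nonzero polynomial in x, of bounded degree, in the
    ideal of P and Q. Its value at g is a multiple of Q(x, g), so the order of the
    latter has the same bound. *)
Lemma minpoly_order g P Q a b : is_minpoly g P -> (1 < size P)%N ->
    (size P <= a)%N -> (size Q <= a)%N -> (sizeY P <= b)%N -> (sizeY Q <= b)%N ->
    (forall l, (l < (2 * a * b).+1)%N -> eval_xT Q g l = 0) ->
  eval_xT Q g = 0.
Proof.
move=> [P0 Pmin] P1 Pa Qa Pb Qb ord; apply: contrapT => /eqP Qg0.
have Pg0 : eval_xT P g = 0 by apply/Pmin; exists 1; rewrite mul1r.
have [Q1|Q1] := leqP (size Q) 1.
  move: Qb Qg0 ord; rewrite (size1_polyC Q1) eval_xTC => Qb Qg0 ord.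
  case/eqP: Qg0; apply: fpsP => l; have [ll|ll] := ltnP l (2 * a * b).+1.
    exact: ord.
  have := size_coef_sizeY 0%N Qb; rewrite coefC eqxx /= => szQ.
  rewrite /= nth_default //; apply: leq_trans szQ _.
  apply: leq_trans ll; apply: leqW; apply: leq_pmull.
  by rewrite muln_gt0 /= (leq_trans _ Pa) // ltnW.
(* a common factor of P and Q would vanish at g, or divide the minimal
   polynomial P with a quotient vanishing at g *)
have res0 : resultant P Q != 0.
  rewrite resultant_eq0 -leqNgt leqNgt; apply/negP => szG.
  set G := gcdp P Q in szG.
  have [[u U] /= u0 UE] := Pdiv.WeakIdomain.dvdpP _ _ (dvdp_gcdl P Q).
  have [[v V] /= v0 VE] := Pdiv.WeakIdomain.dvdpP _ _ (dvdp_gcdr P Q).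
  rewrite -/G -!mul_polyC in UE VE.
  have /eqP : eval_xT U g * eval_xT G g = 0.
    by rewrite -eval_xTM -UE eval_xTM Pg0 mulr0.
  rewrite mulf_eq0 => /orP[/eqP U0|/eqP G0].
  - have /Pmin[S SE] := U0; move: UE; rewrite SE mulrAC => /(mulIf P0) uE.
    have := congr1 (fun q : {poly {poly k}} => size q) uE.
    have [S0|S0] := eqVneq (S * G) 0.
      by rewrite S0 size_polyC u0 size_poly0.
    move: S0; rewrite mulf_eq0 negb_or => /andP[S0 G0].
    rewrite size_mul // size_polyC u0; rewrite -size_poly_gt0 in S0.
    case: (size G) szG => [|[|c]] // _; case: (size S) S0 => // a' _.
    by rewrite addSn !addnS.
  - have := congr1 (fun W : {poly {poly k}} => eval_xT W g) VE.
    rewrite !eval_xTM G0 mulr0 eval_xTC => /eqP.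
    by rewrite mulf_eq0 fps_of_poly_eq0 (negPf v0) (negPf Qg0).
have [[U V] /= _ resE] := resultant_in_ideal P1 Q1.
have rE : fps_of_poly (resultant P Q) = eval_xT V g * eval_xT Q g.
  by rewrite -(eval_xTC _ g) resE eval_xTD !eval_xTM Pg0 mulr0 add0r.
have szr := size_resultant Pa Qa Pb Qb.
case/eqP: res0; apply/polyP => l; rewrite coef0.
have [ll|ll] := ltnP l (2 * a * b).+1; last first.
  by rewrite nth_default // (leq_trans szr).
rewrite -[LHS]/(fps_of_poly (resultant P Q) l) rE fps_coefM.
apply: big1 => j _; rewrite ord ?mulr0 //.
by apply: leq_ltn_trans ll; apply: leq_subr.
Qed.
End MinimalPolynomials.

(** * The minimal polynomial as solution of a linear system *)

(** A linear system over a subfield that is solvable over K is solvable over the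
    subfield, and here the solution is unique. *)
Lemma descend_row (K : fieldType) (C : {pred K}) m p (M : 'M[K]_(m, p))
    (r : 'rV[K]_m) (t : 'rV[K]_p) : divring_closed C ->
    (forall i j, M i j \in C) -> (forall j, t 0 j \in C) ->
    row_free M -> r *m M = t -> forall i, r 0 i \in C.
Proof.
move=> Ccl MC tC Mfree rM i.
have [F [f fP]] := subfield_image Ccl.
have /choice[M0 M0E] : forall ij, exists a, f a = M ij.1 ij.2.
  by move=> ij; apply/fP/MC.
have /choice[t0 t0E] : forall j, exists a, f a = t 0 j.
  by move=> j; apply/fP/tC.
pose M1 := \matrix_(i, j) M0 (i, j); pose t1 := \row_j t0 j.
have M1E : map_mx f M1 = M by apply/matrixP => a b; rewrite !mxE M0E.
have t1E : map_mx f t1 = t by apply/rowP => b; rewrite !mxE t0E.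
have /submxP[r1 r1E] : (t1 <= M1)%MS.
  by rewrite -(map_submx f) M1E t1E -rM submxMl.
suff -> : r = map_mx f r1 by apply/fP; exists (r1 0 i); rewrite mxE.
by apply: (row_free_inj Mfree); rewrite rM -t1E r1E map_mxM M1E.
Qed.

(** Polynomials of degree less than a in T and less than b in x are encoded as rows
    of length a * b: the coefficient of x^i T^j is at place j * b + i. *)
Section Box.
Variables (k : fieldType) (a b : nat).
Hypothesis b0 : (0 < b)%N.
Implicit Types (g : fps k) (Q R : {poly {poly k}}).
Local Notation m := (a * b)%N.

Definition box_poly (w : 'rV[k]_m) : {poly {poly k}} :=
  \sum_(c < m) (w 0 c *: 'X^(c %% b))%:P * 'X^(c %/ b).

Definition box_row Q : 'rV[k]_m := \row_c Q`_(c %/ b)`_(c %% b).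

Lemma coef_box_poly w j i : (box_poly w)`_j`_i =
  \sum_(c < m | (c %/ b == j)%N && (c %% b == i)%N) w 0 c.
Proof.
rewrite /box_poly !coef_sum [RHS]big_mkcond; apply: eq_bigr => c _.
rewrite coefCM coefXn eq_sym; case: eqP => _; last by rewrite mulr0 coef0.
by rewrite mulr1 coefZ coefXn eq_sym; case: eqP; rewrite ?mulr1 ?mulr0.
Qed.

Lemma coef_box_polyE w (c : 'I_m) : (box_poly w)`_(c %/ b)`_(c %% b) = w 0 c.
Proof.
rewrite coef_box_poly (big_pred1 c) // => c'; apply/andP/eqP => [[/eqP e /eqP e']|->//].
by apply: val_inj => /=; rewrite (divn_eq c' b) e e' -divn_eq.
Qed.

Lemma box_rowK Q : (size Q <= a)%N -> (sizeY Q <= b)%N -> box_poly (box_row Q) = Q.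
Proof.
move=> Qa Qb; apply/polyP => j; apply/polyP => i.
have [ltij|] := boolP ((j < a)%N && (i < b)%N).
  have [ja ib] := andP ltij.
  have ltm : (j * b + i < m)%N.
    by rewrite -addnS (leq_trans (leq_add (leqnn _) ib)) // -mulSnr leq_mul2r ja orbT.
  have := coef_box_polyE (box_row Q) (Ordinal ltm).
  by rewrite /= mxE /= divnMDl // divn_small // addn0 modnMDl modn_small.
rewrite negb_and -!leqNgt => le.
have -> : Q`_j`_i = 0.
  case/orP: le => [aj|bi]; last exact: coef_sizeY bi.
  by rewrite [Q`_j]nth_default ?coef0 // (leq_trans Qa).
rewrite coef_box_poly big_pred0 // => c; apply/negP => /andP[/eqP cj /eqP ci].
have ltc : (c %/ b < a)%N by rewrite ltn_divLR.
have := ltn_pmod c b0; case/orP: le; rewrite -?cj -?ci leqNgt.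
  by rewrite ltc.
by move=> /negPf ->.
Qed.

Lemma eval_box_poly w g l : eval_xT (box_poly w) g l =
  \sum_(c < m) w 0 c * (fps_of_poly 'X^(c %% b) * g ^+ (c %/ b)) l.
Proof.
rewrite /box_poly eval_xT_sum fps_coef_sum; apply: eq_bigr => c _.
rewrite eval_xTM eval_xTC eval_xTXn -mul_polyC (rmorphM (@fps_of_poly k)) -mulrA.
by rewrite coef_fps_CM.
Qed.

(** The linear system on Q that singles out R: the first N coefficients of Q(x, g),
    the coefficients of Q beyond the bidegree of R, and the coefficient of T. *)
Definition box_mx (N : nat) R g : 'M[k]_(m, N + (m + 1)) :=
  row_mx (\matrix_(c, l) (fps_of_poly 'X^(c %% b) * g ^+ (c %/ b)) l)
    (row_mx (diag_mx (\row_c ((size R <= c %/ b) || (sizeY R <= c %% b))%N%:R))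
       (\col_c (c == b :> nat)%:R)).

Definition box_target (F : fieldType) N : 'rV[F]_(N + (m + 1)) := row_mx 0 (row_mx 0 1%:M).

Lemma mul_box_mx N R g w : (1 < a)%N -> w *m box_mx N R g =
  row_mx (\row_l eval_xT (box_poly w) g l)
    (row_mx (\row_c (w 0 c * ((size R <= c %/ b) || (sizeY R <= c %% b))%N%:R))
       ((box_poly w)`_1`_0)%:M).
Proof.
move=> a1; rewrite /box_mx !mul_mx_row; congr (row_mx _ (row_mx _ _)).
- apply/rowP => l; rewrite !mxE eval_box_poly; apply: eq_bigr => c _.
  by rewrite mxE.
- by apply/rowP => c; rewrite mul_mx_diag !mxE.
- apply/rowP => l; rewrite !ord1 !mxE eqxx mulr1n.
  have ltm : (b < m)%N by rewrite -[X in (X < _)%N]mul1n ltn_mul2r b0.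
  have := coef_box_polyE w (Ordinal ltm); rewrite /= divnn b0 modnn => ->.
  rewrite (bigD1 (Ordinal ltm)) //= mxE eqxx mulr1 big1 ?addr0 // => c.
  by rewrite -val_eqE /= mxE => /negPf ->; rewrite mulr0.
Qed.

Lemma coef10_size R : R`_1`_0 = 1 -> (1 < size R)%N.
Proof.
move=> R1; rewrite ltnNge; apply/negP => szR.
by move/eqP: R1; rewrite [R`_1]nth_default // coef0 eq_sym oner_eq0.
Qed.

Lemma box_row_mx N R g : is_minpoly g R -> R`_1`_0 = 1 ->
    (size R <= a)%N -> (sizeY R <= b)%N ->
  box_row R *m box_mx N R g = box_target k N.
Proof.
move=> [_ Rmin] R10 Ra Rb.
have a1 : (1 < a)%N by rewrite (leq_trans (coef10_size R10)).
have Rg : eval_xT R g = 0 by apply/Rmin; exists 1; rewrite mul1r.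
rewrite mul_box_mx // box_rowK // R10 Rg; congr (row_mx _ (row_mx _ _)).
  by apply/rowP => l; rewrite !mxE.
apply/rowP => c; rewrite !mxE.
case: leqP => [sz|_]; first by rewrite [R`__]nth_default // coef0 mul0r.
case: leqP => [sz|_]; last by rewrite mulr0.
by rewrite (coef_sizeY _ (leqnn _) sz) mul0r.
Qed.

(** By minpoly_order, a solution of the homogeneous system vanishes at g. It is
    then a multiple of R, by a constant because of the bidegree, and the
    coefficient of T shows that this constant is 0. *)
Lemma minpoly_box_free R g : is_minpoly g R -> R`_1`_0 = 1 ->
    (size R <= a)%N -> (sizeY R <= b)%N ->
  row_free (box_mx (2 * a * b).+1 R g).
Proof.
move=> Rmin R10 Ra Rb; have R1 := coef10_size R10.
have a1 : (1 < a)%N by rewrite (leq_trans R1).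
apply: inj_row_free => w; rewrite mul_box_mx //.
rewrite -[RHS]row_mx0 -[X in _ = row_mx _ X]row_mx0.
move=> /eq_row_mx[/rowP wS /eq_row_mx[/rowP wD /rowP /(_ 0) wl]].
set Q := box_poly w in wS wl.
have {}wD (c : 'I_m) : (size R <= c %/ b)%N || (sizeY R <= c %% b)%N -> w 0 c = 0.
  by move=> h; have := wD c; rewrite !mxE h mulr1.
have {}wl : Q`_1`_0 = 0 by move: wl; rewrite !mxE eqxx.
have QR : (size Q <= size R)%N.
  apply/leq_sizeP => j Rj; apply/polyP => i; rewrite coef0 coef_box_poly.
  by apply: big1 => c /andP[/eqP cj _]; apply: wD; rewrite cj Rj.
have QYR : (sizeY Q <= sizeY R)%N.
  apply: sizeY_leq => j; apply/leq_sizeP => i Ri; rewrite coef_box_poly.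
  by apply: big1 => c /andP[_ /eqP ci]; apply: wD; rewrite ci Ri orbT.
have Qg : eval_xT Q g = 0.
  apply: (minpoly_order (a := a) (b := b) Rmin R1) => //.
  - exact: leq_trans QR Ra.
  - exact: leq_trans QYR Rb.
  by move=> l ltl; have := wS (Ordinal ltl); rewrite !mxE.
have [_ /(_ Q)[/(_ Qg)[S QE] _]] := Rmin.
suff Q0 : Q = 0.
  by apply/rowP => c; rewrite -coef_box_polyE -/Q Q0 !coef0 mxE.
have R0 : R != 0 by case: Rmin.
apply: contrapT => /eqP Q0.
have S0 : S != 0 by apply: contra_neq Q0 => S0; rewrite QE S0 mul0r.
have S1 : (size S <= 1)%N.
  move: QR; rewrite QE size_mul //; move: R1 S0; rewrite -size_poly_gt0.
  case: (size R) => // c _; case: (size S) => // d _.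
  by rewrite addSn /= -[X in (_ <= X)%N]add0n leq_add2r leqn0 => /eqP ->.
have {S1} [s sE] : exists s, S = s%:P by exists S`_0; apply: size1_polyC.
have s0 : s != 0 by apply: contra_neq S0 => s0; rewrite sE s0.
have s1 : (size s <= 1)%N.
  move: QYR; rewrite QE !sizeYE rmorphM sE /= swapXY_polyC size_mul; first last.
  - by rewrite swapXY_eq0.
  - by rewrite map_polyC_eq0.
  rewrite size_map_polyC; have : (0 < size (swapXY R))%N.
    by rewrite size_poly_gt0 swapXY_eq0.
  case: (size (swapXY R)) => // c _; move: s0; rewrite -size_poly_gt0.
  case: (size s) => // d _.
  by rewrite addSn /= -[X in (_ <= X)%N]add0n leq_add2r leqn0 => /eqP ->.
move: s0 wl; rewrite QE sE (size1_polyC s1) coefCM coefCM R10 mulr1 => s0 s00.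
by rewrite s00 eqxx in s0.
Qed.

End Box.

(** * Coordinates of algebraic series *)

Section Coordinates.
Variables (k : fieldType) (d h : nat).
Implicit Types (f g : fps k) (P Q R : {poly {poly k}}) (p q r : {poly k}).

Lemma size_mul_leq p q u v : (size p <= u.+1)%N -> (size q <= v.+1)%N ->
  (size (p * q)%R <= (u + v).+1)%N.
Proof.
move=> pu qv; apply: leq_trans (size_polyMleq _ _) _.
by rewrite -subn1 leq_subLR add1n -addnS -addSn leq_add.
Qed.

Lemma sizeY_comp_linear P e p : (size P <= d.+1)%N -> (sizeY P <= h.+1)%N ->
    (size p <= e.+1)%N ->
  (sizeY (P \Po (('X^e)%:P * 'X + p%:P)) <= (h + d * e).+1)%N.
Proof.
move=> Pd Ph pe; set L := _ + _.
have szL j : forall i, (size ((L ^+ j)`_i)%R <= (j * e).+1)%N.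
  elim: j => [|j IHj] i.
    by rewrite expr0 coef1; case: (i == 0%N); rewrite ?size_poly1 ?size_poly0.
  rewrite exprS mulrDl coefD -mulrA !coefCM coefXM.
  apply: leq_trans (size_polyD _ _) _; rewrite geq_max mulSn; apply/andP; split.
    apply: size_mul_leq; first by rewrite size_polyXn.
    by case: (i == 0%N); rewrite ?size_poly0.
  exact: size_mul_leq.
apply: sizeY_leq => i; rewrite comp_polyE coef_sum.
apply: leq_trans (size_sum _ _ _) _; apply/bigmax_leqP => j _.
rewrite coefZ; have Pj := size_coef_sizeY j Ph.
apply: leq_trans (size_mul_leq Pj (szL j i)) _.
rewrite ltnS leq_add2l leq_mul2r -ltnS (leq_trans (ltn_ord j) Pd) orbT //.
Qed.

(** If f = p + x^e g, then g is a root of P(x, p + x^e T), of which R is therefore a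
    divisor. *)
Lemma minpoly_bound P R f g p e : P != 0 -> eval_xT P f = 0 ->
    (size P <= d.+1)%N -> (sizeY P <= h.+1)%N -> (size p <= e.+1)%N ->
    f = fps_of_poly p + fps_of_poly 'X^e * g -> is_minpoly g R ->
  (size R <= d.+1)%N /\ (sizeY R <= (h + d * e).+1)%N.
Proof.
move=> P0 Pf Pd Ph pe fE [R0 Rmin]; pose L : {poly {poly k}} := ('X^e)%:P * 'X + p%:P.
have X0 : 'X^e != 0 :> {poly k} by rewrite expf_neq0 ?polyX_eq0.
have szL : size L = 2.
  by rewrite size_MXaddC polyC_eq0 (negPf X0) size_polyC X0.
have PLg : eval_xT (P \Po L) g = 0.
  rewrite -Pf fE /eval_xT map_comp_poly horner_comp; congr (_.[_]).
  by rewrite rmorphD rmorphM /= !map_polyC map_polyX !hornerE addrC.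
have PL0 : P \Po L != 0 by rewrite comp_poly2_eq0.
have [S SE] := (Rmin _).1 PLg.
have S0 : S != 0 by apply: contra_neq PL0 => S0; rewrite SE S0 mul0r.
have le_mul (u v : nat) : (0 < u)%N -> (v <= (u + v).-1)%N.
  by case: u => // u _; rewrite addSn leq_addl.
split.
  apply: leq_trans Pd; rewrite -(size_comp_poly2 P szL) SE size_mul //.
  by rewrite le_mul // size_poly_gt0.
apply: leq_trans (sizeY_comp_linear Pd Ph pe); rewrite -/L SE !sizeYE rmorphM /=.
by rewrite size_mul ?swapXY_eq0 // le_mul // size_poly_gt0 swapXY_eq0.
Qed.

(** A bound for the height of R that is uniform in e; it is not the sharp one that
    fixes the number of coordinates. *)
Definition box_height := (h + d * ord_bound d h).+1.

(** The data attached to a series f: a polynomial P that vanishes at f, the integer e,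
    the series f^(1) and its minimal polynomial R. The polynomial f^(0) is a
    truncation of f. *)
Record branch := Branch {
  br_f : fps k; br_P : {poly {poly k}};
  br_e : nat; br_f1 : fps k; br_R : {poly {poly k}} }.

Definition branch_bounds (b : branch) :=
  [/\ (size (br_P b) <= d.+1)%N, (sizeY (br_P b) <= h.+1)%N,
      (size (br_R b) <= d.+1)%N & (sizeY (br_R b) <= box_height)%N].

Definition is_branch (b : branch) (w : 'rV[k]_(1 + dimN d h)) :=
  [/\ eval_xT (br_P b) (br_f b) = 0,
      exists ij : 'I_d.+1 * 'I_h.+1, (br_P b)`_ij.1`_ij.2 = 1,
      (br_e b <= ord_bound d h)%N,
      is_minpoly (br_f1 b) (br_R b) /\ (br_R b)`_1`_0 = 1
    & (forall l, br_f1 b l = if l == 0%N then 0 else br_f b (l + br_e b)%N)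
      /\ w = row_mx (br_f b 0%N)%:M
        (row_mx (\row_(i < (ord_bound d h).+1) (i == br_e b :> nat)%:R)
          (row_mx (\row_(i < ord_bound d h) if (i < br_e b)%N then br_f b i.+1 else 0)
            (mxvec (\matrix_(i < (height_bound d h).+1, j < d.+1)
              (br_R b)`_j`_i))))].

(** P is the minimal polynomial of f divided by one of its nonzero coefficients. *)
Lemma coordinates_branch f (w : 'rV[k]_(1 + dimN d h)) :
    alg_series d h f -> coordinates f w ->
  exists b, [/\ br_f b = f, branch_bounds b & is_branch b w].
Proof.
move=> [P [[P0 Pmin] Pd Ph]].
move=> [e [v [ele [[[Q [[Q0 Qmin] Qd Qh]] g0] _] vchart ->]]].
have Pf : eval_xT P f = 0 by apply/Pmin; exists 1; rewrite mul1r.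
have Qg := (Qmin Q).2 (ex_intro _ 1 (esym (mul1r Q))).
case: vchart => f0 [f1 [R [[szf0 f00 f10 gE] Rmin R10 ->]]].
have [Rd Rh] := minpoly_bound Q0 Qg Qd Qh szf0 gE Rmin.
have {}R10 : R`_1`_0 = 1.
  by move: R10; rewrite !horner_coef0 coef_deriv mulr1n.
have fl l : f l.+1 = f0`_l.+1 + (if (l < e)%N then 0 else f1 (l.+1 - e)%N).
  have := congr1 (fun g : fps k => g l.+1) gE.
  rewrite !fps_coefD fps_coefN coef_fps_XnM /= coefC subr0 => ->.
  congr (_ + _); case: (ltngtP l.+1 e) => // <-; by rewrite subnn f10.
pose i0 := (size P).-1; pose p := P`_i0.
have p0 : p != 0 by rewrite /p -lead_coefE lead_coef_eq0.
pose c := lead_coef p; have c0 : c != 0 by rewrite lead_coef_eq0.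
exists (Branch f ((c^-1)%:P *: P) e f1 R); split=> //; split=> //=.
- exact: leq_trans (size_scale_leq _ _) Pd.
- apply: sizeY_leq => j; rewrite coefZ mul_polyC.
  exact: leq_trans (size_scale_leq _ _) (size_coef_sizeY j Ph).
- apply: leq_trans Rh _; rewrite ltnS leq_add2l leq_mul2l ele orbT //.
- by rewrite -mul_polyC eval_xTM Pf mulr0.
- have lti0 : (i0 < d.+1)%N by rewrite /i0 prednK ?size_poly_gt0.
  have ltc : ((size p).-1 < h.+1)%N.
    by rewrite prednK ?size_poly_gt0 //; apply: size_coef_sizeY.
  exists (Ordinal lti0, Ordinal ltc).
  by rewrite /= coefZ mul_polyC coefZ -/p -lead_coefE mulVf.
- split=> [[|l]|]; rewrite ?f10 //=.
    rewrite addSn fl ltnNge leq_addl /= -addSn addnK.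
    by rewrite [f0`_ _]nth_default ?add0r // (leq_trans szf0) // ltnS leq_addl.
  congr (row_mx _ (row_mx _ (row_mx _ _))); apply/rowP => i; rewrite !mxE fl.
  case: ltnP => lt; first by rewrite addr0.
  by rewrite nth_default // (leq_trans szf0).
Qed.

End Coordinates.

(** * Generic points *)

Section ConstantFunctions.
Variables (k K : comNzRingType) (A : pointedType) (T : {rmorphism (A -> k) -> K}).

Lemma const_rmorphism : exists g : {rmorphism k -> K}, forall a, g a = T (fun=> a).
Proof.
pose f a := T (fun=> a).
have fB : zmod_morphism f by move=> a b; rewrite /f -rmorphB.
have fM : monoid_morphism f.
  by split=> [|a b]; rewrite /f -?rmorphM // -(rmorph1 T).
pose g : {rmorphism k -> K} := HB.pack f (GRing.isZmodMorphism.Build _ _ f fB)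
  (GRing.isMonoidMorphism.Build _ _ f fM).
by exists g.
Qed.

(** Evaluation at the generic point T (y) is the image under T of the evaluations at
    the points y z. *)
Lemma rmorph_meval n (y : A -> 'I_n -> k) (g : {rmorphism {mpoly k[n]} -> K}) :
    (forall a, g (mpolyC n a) = T (fun=> a)) ->
    (forall j, g (mpolyX k (mnm1 j)) = T (fun z => y z j)) ->
  forall q, g q = T (fun z => meval (y z) q).
Proof.
move=> gC gX q; apply/eqP.
apply: (polynomial_ring_ind (mpoly_polynomial_ring k n)
  (C := [pred q | g q == T (fun z => meval (y z) q)])) => [|a|j].
- split=> [|u v|u v]; rewrite !inE.
  + rewrite rmorph1 -(rmorph1 T); apply/eqP; congr (T _).
    by apply/funext => z; rewrite meval1.
  + rewrite rmorphB => /eqP -> /eqP ->; rewrite -rmorphB; apply/eqP; congr (T _).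
    by apply/funext => z; rewrite mevalB.
  + rewrite rmorphM => /eqP -> /eqP ->; rewrite -rmorphM; apply/eqP; congr (T _).
    by apply/funext => z; rewrite mevalM.
- rewrite inE gC; apply/eqP; congr (T _); apply/funext => z.
  by rewrite mevalC.
- rewrite inE gX; apply/eqP; congr (T _); apply/funext => z.
  by rewrite mevalXU.
Qed.

End ConstantFunctions.

(** A pointed copy of the affine space, whose functions form a nonzero ring. *)
Definition affine (k : fieldType) (N : nat) : Type := 'rV[k]_N.
HB.instance Definition _ k N := Choice.on (affine k N).
HB.instance Definition _ (k : fieldType) N := isPointed.Build (affine k N) (0 : 'rV[k]_N).

(** A prime ideal of the ring of all functions on the affine space, containing the
    functions that vanish on E and avoiding the polynomials outside P. Its residue
    field behaves like an ultrapower of k over E: data chosen arbitrarily at each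
    point of E have an image in K, where identities valid on E persist. *)
Lemma generic_point (k : fieldType) N (E : set (affine k N)) (P : {pred {mpoly k[N]}}) :
    is_prime P -> (forall p, vanishing E p -> p \in P) ->
  exists (K : fieldType) (ev : {rmorphism (affine k N -> k) -> K}),
    (forall g g', (forall z, E z -> g z = g' z) -> ev g = ev g') /\
    (forall p, ev (fun z : 'rV[k]_N => meval (fun i => z 0 i) p) = 0 -> p \in P).
Proof.
move=> [[P0 P1 PD] Ppr] EP.
pose fn p : affine k N -> k := fun z : 'rV[k]_N => meval (fun i => z 0 i) p.
pose I (g : affine k N -> k) := forall z, E z -> g z = 0.
pose S (g : affine k N -> k) := exists2 p, p \notin P & g = fn p.
have [||||u Iu [p pP uE]|M [Mid Mpr IM SM]] := @prime_avoiding _ I S.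
- by [].
- move=> g u v Iu Iv z Ez.
  by rewrite -[(g * u + v) z]/(g z * u z + v z) Iu // Iv // mulr0 addr0.
- by exists 1 => //; apply/funext => z; rewrite /fn meval1.
- move=> _ _ [p pP ->] [q qP ->]; exists (p * q).
    by apply/negP => /Ppr; rewrite (negPf pP) (negPf qP).
  by apply/funext => z; rewrite /fn mevalM.
- by case/negP: pP; apply: EP => z Ez; have := Iu z Ez; rewrite uE.
have [K [ev evP]] := prime_field Mid Mpr.
exists K, ev; split=> [g g' gg'|p evp].
  apply/eqP; rewrite -subr_eq0 -rmorphB evP; apply: IM => z Ez.
  by rewrite -[(g - g') z]/(g z - g' z) gg' // subrr.
apply: contrapT => /negP pP.
have /negP : fn p \notin M by apply: SM; exists p.
by apply; rewrite -evP; apply/eqP.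
Qed.

Section MapFps.
Variables (k K : fieldType) (g : {rmorphism k -> K}).

Definition fps_map (f : fps k) : fps K := Fps (fun l => g (f l)).
Fact fps_map_zmod : zmod_morphism fps_map.
Proof. by move=> f f'; apply: fpsP => l /=; rewrite rmorphB. Qed.
Fact fps_map_monoid : monoid_morphism fps_map.
Proof.
split=> [|f f']; apply: fpsP => l; first by rewrite /= rmorph_nat.
by rewrite fps_coefM /= rmorph_sum; apply: eq_bigr => j _; rewrite rmorphM.
Qed.
HB.instance Definition _ := GRing.isZmodMorphism.Build (fps k) (fps K)
  fps_map fps_map_zmod.
HB.instance Definition _ := GRing.isMonoidMorphism.Build (fps k) (fps K)
  fps_map fps_map_monoid.

Lemma laurent_map : exists G : {rmorphism laurent k -> laurent K},
  forall f, G (tofrac f) = tofrac (fps_map f).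
Proof.
have inj : injective (@tofrac (fps K) \o fps_map).
  move=> f f' /eqP /=; rewrite tofrac_eq => /eqP ff'; apply: fpsP => l.
  by apply: (fmorph_inj g); have := congr1 (fun u : fps K => u l) ff'.
have [G GE] := fraction_lift inj.
by exists G.
Qed.

End MapFps.

Lemma polynomial_clear_denominators (R : idomainType) n (A B : comNzRingType)
    (cA : {rmorphism R -> A}) (xA : 'I_n -> A)
    (cB : {rmorphism {fraction R} -> B}) (xB : 'I_n -> B) (T : {rmorphism A -> B}) :
    polynomial_ring cB xB ->
    (forall a, T (cA a) = cB (tofrac a)) -> (forall j, T (xA j) = xB j) ->
  forall p, exists c q, c != 0 /\ cB (tofrac c) * p = T q.
Proof.
move=> polB TC TX p.
pose C := [pred p | `[< exists c q, c != 0 /\ cB (tofrac c) * p = T q >]].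
suff /asboolP : p \in C by [].
apply: (polynomial_ring_ind polB) => [|u|j].
- split=> [|u v /asboolP[c [q [c0 qE]]] /asboolP[c' [q' [c0' qE']]]
            |u v /asboolP[c [q [c0 qE]]] /asboolP[c' [q' [c0' qE']]]]; apply/asboolP.
  + by exists 1, 1; rewrite oner_neq0 !rmorph1 mulr1.
  + exists (c * c'), (cA c' * q - cA c * q'); rewrite mulf_neq0 //; split=> //.
    by rewrite rmorphB !rmorphM /= !TC -qE -qE'; ring.
  + exists (c * c'), (q * q'); rewrite mulf_neq0 //; split=> //.
    by rewrite !rmorphM /= -qE -qE'; ring.
- have [a [b [b0 uE]]] := fractionP u; apply/asboolP; exists b, (cA a).
  split=> //; rewrite TC -rmorphM uE mulrC divfK //.
  by rewrite tofrac_eq0.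
- apply/asboolP; exists 1, (xA j); rewrite oner_neq0; split=> //.
  by rewrite TX !rmorph1 mul1r.
Qed.

(** * The generic point of the set of bounded points *)

(** Branches are given at all points, but they describe the point only on E. *)
Section GenericBranches.
Variables (k : fieldType) (n d h : nat).
Local Notation A := (affine k (n * (1 + dimN d h))).
Variables (E : set A) (br : A -> 'I_n -> branch k).
Hypothesis br_bounds : forall z i, branch_bounds d h (br z i).
Hypothesis brE : forall z, E z -> forall i,
  is_branch (br z i) (row i (vec_mx (z : 'rV[k]_(n * (1 + dimN d h))))).
Variables (K : fieldType) (ev : {rmorphism (A -> k) -> K}).
Hypothesis evE : forall g g', (forall z, E z -> g z = g' z) -> ev g = ev g'.

Definition generic_f i : fps K := fps_transfer ev (fun z => br_f (br z i)).
Definition generic_P i : {poly {poly K}} :=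
  poly2_transfer ev d.+1 h.+1 (fun z => br_P (br z i)).

Lemma coef_generic_P i j l : (generic_P i)`_j`_l = ev (fun z => (br_P (br z i))`_j`_l).
Proof. by apply: coef_poly2_transfer => z; case: (br_bounds z i). Qed.

Lemma generic_P_root i : eval_xT (generic_P i) (generic_f i) = 0.
Proof.
rewrite eval_xT_transfer; first last.
- by move=> z; case: (br_bounds z i).
- by move=> z; case: (br_bounds z i).
apply: fpsP => l; rewrite fps_coef0 -(rmorph0 ev); apply: evE => z Ez.
by have [-> _ _ _ _] := brE Ez i.
Qed.

(** The place of a coefficient equal to 1 depends on the point, but the product of
    all the (coefficient - 1) vanishes on E, hence one of its factors does in K. *)
Lemma generic_P_pivot i : exists ij : 'I_d.+1 * 'I_h.+1, (generic_P i)`_ij.1`_ij.2 = 1.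
Proof.
have : \prod_(ij : 'I_d.+1 * 'I_h.+1)
    (ev (fun z => (br_P (br z i))`_ij.1`_ij.2) - 1) = 0.
  under eq_bigr do rewrite -(rmorph1 ev) -rmorphB.
  rewrite -rmorph_prod -(rmorph0 ev); apply: evE => z Ez.
  have [_ [ij ij1] _ _ _] := brE Ez i.
  rewrite (bigD1 ij) //= -[LHS]/(_ * _) -[X in X * _]/(_ - _) ij1.
  by rewrite -[X in _ - X]/(1 : k) subrr mul0r.
move/eqP; rewrite prodf_seq_eq0 => /hasP[ij _ /eqP h0].
by exists ij; rewrite coef_generic_P; apply/eqP; rewrite -subr_eq0 h0.
Qed.

Section InClosedField.
Variable C : {pred K}.
Hypothesis Ccl : closed_subfield C.
Hypothesis Cconst : forall a : k, ev (fun=> a) \in C.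

Let Csub := divring_subring Ccl.1.
Let C0 : 0 \in C. Proof. by have [C1 CB _] := Csub; rewrite -(subrr 1); apply: CB. Qed.
Let C1 : 1 \in C. Proof. by have [] := Csub. Qed.

(** A function with values 0 and 1 is idempotent. This makes all conditions that
    vary from point to point, such as the value of e, harmless. *)
Lemma ev_bool (g : A -> k) : (forall z, E z -> g z = 0 \/ g z = 1) -> ev g \in C.
Proof.
move=> g01; have /eqP : ev g * (ev g - 1) = 0.
  rewrite -(rmorph1 ev) -rmorphB -rmorphM -(rmorph0 ev); apply: evE => z Ez.
  rewrite -[LHS]/(g z * (g z - 1)).
  by case: (g01 z Ez) => ->; rewrite ?mul0r ?subrr ?mulr0.
by rewrite mulf_eq0 subr_eq0 => /orP[] /eqP ->.
Qed.

Lemma generic_f_over i : (forall j l, (generic_P i)`_j`_l \in C) -> generic_f i \in fps_over C.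
Proof.
move=> PC; apply: (root_fps_over Ccl _ _ (generic_P_root i)).
- by move=> j; apply/fps_overP => l; rewrite coef_map; apply: PC.
- have [ij ij1] := generic_P_pivot i; apply/eqP => P0.
  have := congr1 (fun Q : {poly fps K} => Q`_ij.1 ij.2) P0.
  by rewrite coef_map coef0 /= ij1 => /eqP; rewrite oner_eq0.
Qed.

Hypothesis fC : forall i, generic_f i \in fps_over C.

Let evf_C i l : ev (fun z => br_f (br z i) l) \in C.
Proof. by have /fps_overP := fC i; apply. Qed.

Lemma ev_shift i (g : A -> nat -> k) l :
    (forall z e, E z -> g z e = 0 \/ g z e = 1) ->
  ev (fun z => g z (br_e (br z i)) * br_f (br z i) (l + br_e (br z i))%N) \in C.
Proof.
move=> g01.
pose D : subringClosed K := HB.pack C (GRing.isSubringClosed.Build K C Csub).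
have -> : ev (fun z => g z (br_e (br z i)) * br_f (br z i) (l + br_e (br z i))%N) =
    ev (\sum_(e < (ord_bound d h).+1)
      (fun z => (br_e (br z i) == e)%:R * g z e) * (fun z => br_f (br z i) (l + e)%N)).
  apply: evE => z Ez; rewrite fct_sumE.
  have [_ _ ele _ _] := brE Ez i; rewrite -ltnS in ele.
  transitivity (\sum_(e < (ord_bound d h).+1)
    (br_e (br z i) == e)%:R * g z e * br_f (br z i) (l + e)%N); last by [].
  rewrite (bigD1 (Ordinal ele)) //= eqxx mul1r big1 ?addr0 // => e.
  by rewrite -val_eqE eq_sym /= => /negPf ->; rewrite !mul0r.
rewrite rmorph_sum; apply: (@rpred_sum _ D) => e _; rewrite rmorphM.
apply: (@rpredM _ D); last exact: evf_C.
apply: ev_bool => z Ez; case: eqP => _; rewrite ?mul0r ?mul1r; last by left.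
exact: g01.
Qed.

Lemma generic_f1_over i : fps_transfer ev (fun z => br_f1 (br z i)) \in fps_over C.
Proof.
apply/fps_overP => l /=.
rewrite (_ : ev _ = ev (fun z => (l != 0%N)%:R * br_f (br z i) (l + br_e (br z i))%N)).
  by apply: (@ev_shift i (fun _ _ => (l != 0%N)%:R) l) => z e Ez; case: (l != 0%N); [right|left].
apply: evE => z Ez; have [_ _ _ _ [-> _]] := brE Ez i.
by case: eqP => _; rewrite ?mul0r ?mul1r.
Qed.

(** The right inverse of the linear system at each point has an image over K, so the
    system remains injective over K. Its coefficients come from f^(1), so its
    solution R has coefficients in C. *)
Lemma generic_R_over i j l : (j < d.+1)%N -> (l < box_height d h)%N ->
  ev (fun z => (br_R (br z i))`_j`_l) \in C.
Proof.
set a := d.+1; set b := box_height d h; pose N := (2 * a * b).+1 => ja lb.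
have b0 : (0 < b)%N by [].
pose R z := br_R (br z i); pose g z := br_f1 (br z i).
have Rz z : E z -> [/\ is_minpoly (g z) (R z), (R z)`_1`_0 = 1,
    (size (R z) <= a)%N & (sizeY (R z) <= b)%N].
  by move=> Ez; have [_ _ _ [? ?] _] := brE Ez i; have [] := br_bounds z i.
pose M z := box_mx a b N (R z) (g z).
pose MK := \matrix_(c, s) ev (fun z => M z c s).
pose rK := \row_c ev (fun z => box_row a b (R z) 0 c).
have MKfree : row_free MK.
  apply/row_freeP; exists (\matrix_(s, c) ev (fun z => pinvmx (M z) s c)).
  apply/matrixP => c c'; rewrite !mxE.
  under eq_bigr do rewrite !mxE -rmorphM.
  rewrite -rmorph_sum -(rmorph_nat ev); apply: evE => z Ez.
  have [Rmin R10 Ra Rb] := Rz z Ez.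
  have := mulmxVp (minpoly_box_free b0 Rmin R10 Ra Rb).
  move=> /matrixP/(_ c c'); rewrite !mxE fct_sumE natmulfctE.
  by [].
have rMK : rK *m MK = box_target _ _ K N.
  apply/rowP => s; rewrite !mxE.
  under eq_bigr do rewrite !mxE -rmorphM.
  rewrite -rmorph_sum.
  transitivity (ev (fun=> box_target a b k N 0 s)).
    apply: evE => z Ez; have [Rmin R10 Ra Rb] := Rz z Ez.
    by rewrite -(box_row_mx b0 N Rmin R10 Ra Rb) !mxE fct_sumE.
  rewrite /box_target !mxE; case: (fintype.split s) => s'; rewrite !mxE.
    exact: rmorph0.
  case: (fintype.split s') => s''; rewrite !mxE ?rmorph0 //.
  by rewrite ord1 eqxx /= rmorph1.
pose D : subringClosed K := HB.pack C (GRing.isSubringClosed.Build K C Csub).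
pose DS : subringClosed (fps K) := HB.pack (fps_over C)
  (GRing.isSubringClosed.Build (fps K) (fps_over C) (fps_over_subring Csub)).
have MKC c s : MK c s \in C.
  rewrite mxE /M /box_mx; case: (split_ordP s) => s' ->.
    rewrite (_ : (fun z => _) = (fun z =>
        (((fun=> fps_of_poly 'X^(c %% b)) * g ^+ (c %/ b)) z) s')); last first.
      by apply/funext => z; rewrite row_mxEl mxE -[in RHS]/(_ * _) exprfctE.
    rewrite -[ev _]/(fps_transfer ev ((fun=> fps_of_poly 'X^(c %% b)) * g ^+ (c %/ b)) s').
    rewrite rmorphM; apply/fps_overP; apply: (@rpredM _ DS); last first.
      by rewrite rmorphXn; apply: (@rpredX _ DS); apply: generic_f1_over.
    by apply/fps_overP => l'; apply: Cconst.
  apply: ev_bool => z _; rewrite row_mxEr; case: (split_ordP s') => s'' ->.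
    rewrite row_mxEl !mxE; case: (c == s''); last by left.
    by rewrite mulr1n; case: (_ || _); [right|left].
  by rewrite row_mxEr !mxE; case: (_ == _); [right|left].
have tC s : box_target a b K N 0 s \in C.
  rewrite /box_target; case: (split_ordP s) => s' ->; first by rewrite row_mxEl mxE.
  rewrite row_mxEr; case: (split_ordP s') => s'' ->; first by rewrite row_mxEl mxE.
  by rewrite row_mxEr !mxE; case: (_ == _).
have ltc : (j * b + l < a * b)%N.
  by rewrite -addnS (leq_trans (leq_add (leqnn _) lb)) // -mulSnr leq_mul2r ja orbT.
have := descend_row Ccl.1 MKC tC MKfree rMK (Ordinal ltc).
rewrite mxE; congr (_ \in C); congr (ev _); apply/funext => z.
by rewrite mxE /= divnMDl // divn_small // addn0 modnMDl modn_small.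
Qed.

Lemma coordinate_over c : ev (fun z : 'rV[k]_(n * (1 + dimN d h)) => z 0 c) \in C.
Proof.
case/mxvec_indexP: c => i c.
pose w (z : 'rV[k]_(n * (1 + dimN d h))) := row i (vec_mx z).
rewrite (_ : ev _ = ev (fun z => w z 0 c)); last first.
  by congr (ev _); apply/funext => z; rewrite /w !mxE.
case: (split_ordP c) => c' ->.
  rewrite (_ : ev _ = ev (fun z => br_f (br z i) 0%N)); first exact: evf_C.
  apply: evE => z Ez; rewrite /w; have [_ _ _ _ [_ ->]] := brE Ez i.
  by rewrite row_mxEl mxE ord1 eqxx.
case: (split_ordP c') => e ->.
  apply: ev_bool => z Ez; rewrite /w; have [_ _ _ _ [_ ->]] := brE Ez i.
  by rewrite row_mxEr row_mxEl mxE; case: eqP; [right|left].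
case: (split_ordP e) => l ->.
  rewrite (_ : ev _ = ev (fun z => (l < br_e (br z i))%N%:R * br_f (br z i) l.+1)).
    pose D : subringClosed K := HB.pack C (GRing.isSubringClosed.Build K C Csub).
    have := rmorphM ev (fun z => (l < br_e (br z i))%N%:R) (fun z => br_f (br z i) l.+1).
    move=> ->; apply: (@rpredM _ D); last exact: evf_C.
    by apply: ev_bool => z _; case: (_ < _)%N; [right|left].
  apply: evE => z Ez; rewrite /w; have [_ _ _ _ [_ ->]] := brE Ez i.
  by rewrite !row_mxEr row_mxEl mxE; case: ifP; rewrite ?mul1r ?mul0r.
case/mxvec_indexP: l => l j.
rewrite (_ : ev _ = ev (fun z => (br_R (br z i))`_j`_l)).
  apply: generic_R_over => //; apply: leq_trans (ltn_ord l) _.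
  by rewrite ltnS leq_add2l mulnC leq_mul2r leq_subr orbT.
apply: evE => z Ez; rewrite /w; have [_ _ _ _ [_ ->]] := brE Ez i.
by rewrite !row_mxEr mxvecE mxE.
Qed.

End InClosedField.
End GenericBranches.

(** * The generic point of the variety *)

Lemma ker_prime (R : comNzRingType) (K : fieldType) (f : {rmorphism R -> K}) :
  is_prime ([pred u | f u == 0] : {pred R}).
Proof.
split; first split.
- by rewrite inE rmorph0.
- by rewrite inE rmorph1 oner_neq0.
- by move=> a u v; rewrite !inE rmorphD rmorphM => /eqP -> /eqP ->; rewrite mulr0 addr0.
- by move=> u v; rewrite !inE rmorphM mulf_eq0.
Qed.

(** The fraction field of C[[x]] inside K((x)). *)
Definition laurent_over (K : fieldType) (C : {pred K}) : {pred laurent K} :=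
  fractions [pred u | `[< exists2 f : fps K, f \in fps_over C & u = tofrac f >]].

Lemma series_pred_subring (K : fieldType) (C : {pred K}) : subring_closed C ->
  subring_closed [pred u : laurent K |
    `[< exists2 f : fps K, f \in fps_over C & u = tofrac f >]].
Proof.
move=> Ccl; have [S1 SB SM] := fps_over_subring Ccl.
split=> [|_ _ /asboolP[f fC ->] /asboolP[g gC ->]
         |_ _ /asboolP[f fC ->] /asboolP[g gC ->]]; apply/asboolP.
- by exists 1; rewrite ?tofrac1.
- by exists (f - g); [apply: SB|rewrite tofracB].
- by exists (f * g); [apply: SM|rewrite tofracM].
Qed.

Lemma algebraic_fps_over (K : fieldType) (C : {pred K}) (A : {pred laurent K})
    (f : fps K) : closed_subfield C -> {subset A <= laurent_over C} ->
  tofrac f \in algebraic_over A -> f \in fps_over C.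
Proof.
move=> Ccl AC /asboolP[p [pA p0 pf]].
have Scl := series_pred_subring (divring_subring Ccl.1).
have [c [_ c0 cp]] := clear_denominators Scl (fun j => AC _ (pA j)).
have /choice[q qP] : forall j, exists q : fps K,
    q \in fps_over C /\ (c *: p)`_j = tofrac q.
  by move=> j; have /asboolP[q qC qE] := cp j; exists q.
pose P := \poly_(j < size (c *: p)) q j.
have PE : map_poly (@tofrac (fps K)) P = c *: p.
  apply/polyP => j; rewrite coef_map coef_poly; case: ltnP => [_|le].
    by have [_ ->] := qP j.
  by rewrite nth_default ?raddf0.
apply: (root_fps_over (P := P) Ccl).
- move=> j; rewrite coef_poly; case: ifP => _; first by case: (qP j).
  by have [_ SB _] := fps_over_subring (divring_subring Ccl.1);
    rewrite -(subrr (q 0%N)); apply: SB; case: (qP 0%N).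
- apply/eqP => P0; have /eqP : c *: p = 0 by rewrite -PE P0 rmorph0.
  by rewrite scaler_eq0 (negPf c0) (negPf p0).
- apply/eqP; rewrite -tofrac_eq0 -horner_map PE hornerZ (rootP pf) mulr0 //.
Qed.

Section SeriesPoint.
Variables (k K : fieldType) (n : nat) (A : pointedType) (E : set A).
Variable ev : {rmorphism (A -> k) -> K}.
Hypothesis evE : forall g g', (forall z, E z -> g z = g' z) -> ev g = ev g'.
Variable f : A -> 'I_n -> fps k.
Let F i := fps_transfer ev (fun z => f z i).

(** Equations over k((x)) are cleared of denominators: those with coefficients in
    k[[x]] hold for the series f z at each point of E, hence for their image. *)
Lemma laurent_point : exists (G : {rmorphism laurent k -> laurent K})
    (psi : {rmorphism {mpoly (laurent k)[n]} -> laurent K}),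
  [/\ forall a, G (tofrac a) = tofrac (fps_transfer ev (fun=> a)),
      forall u, psi (mpolyC n u) = G u,
      forall i, psi (mpolyX (laurent k) (mnm1 i)) = tofrac (F i)
    & forall p, (forall z, E z -> meval (fun i => tofrac (f z i)) p = 0) ->
        psi p = 0].
Proof.
have [g gE] := const_rmorphism ev.
have [G GE] := laurent_map g.
have gT a : fps_map g a = fps_transfer ev (fun=> a).
  by apply: fpsP => l /=; rewrite gE.
have polk := mpoly_polynomial_ring (fps k) n.
have poll := mpoly_polynomial_ring (laurent k) n.
have [psi [psiC psiX]] := polynomial_ring_eval poll G (fun i => tofrac (F i)).
exists G, psi; split=> // [a|p p0]; first by rewrite GE gT.
pose cl : {rmorphism fps k -> {mpoly (laurent k)[n]}} := @mpolyC n (laurent k) \o @tofrac (fps k).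
have [T [TC TX]] := polynomial_ring_eval polk cl (fun i => mpolyX (laurent k) (mnm1 i)).
have [c [q [c0 cq]]] := polynomial_clear_denominators poll TC TX p.
have [chi [chiC chiX]] := polynomial_ring_eval polk (fps_map g) F.
have psiT : psi (T q) = tofrac (chi q).
  apply: (eq_poly_rmorph polk (f := psi \o T) (g := @tofrac (fps K) \o chi)) => [a|i].
    by rewrite /= TC chiC /cl /= psiC GE.
  by rewrite /= TX chiX psiX.
have chiT : chi q = fps_transfer ev (fun z => meval (f z) q).
  apply: rmorph_meval => [a|i]; first by rewrite chiC; apply: gT.
  by rewrite chiX.
have chi0 : chi q = 0.
  rewrite chiT; apply: fpsP => l; rewrite fps_coef0 -(rmorph0 ev); apply: evE => z Ez.
  suff -> : meval (f z) q = 0 by [].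
  apply/eqP; rewrite -tofrac_eq0; apply/eqP.
  transitivity (meval (fun i => tofrac (f z i)) (T q)).
    apply: (eq_poly_rmorph polk (f := @tofrac (fps k) \o meval (f z))
      (g := meval (fun i => tofrac (f z i)) \o T)) => [a|i].
      by rewrite /= TC /cl /= !mevalC.
    by rewrite /= TX !mevalXU.
  by rewrite -cq mevalM p0 // mulr0.
have /eqP : psi (mpolyC n (tofrac c)) * psi p = 0.
  by rewrite -rmorphM cq psiT chi0 rmorph0.
by rewrite psiC mulf_eq0 fmorph_eq0 tofrac_eq0 (negPf c0) => /eqP.
Qed.

End SeriesPoint.

(** * The dimension bound *)

Lemma size_allpairs_setC1 (I T : finType) (S : Type) (B : {set I}) (f : I -> T -> S)
    (piv : I -> T) :
  size [seq f i t | i <- enum B, t <- enum [set~ piv i]] = (#|B| * #|T|.-1)%N.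
Proof.
rewrite size_allpairs_dep sumnE big_map.
rewrite (eq_bigr (fun=> #|T|.-1)) => [|i _]; last by rewrite -cardE cardsC1.
by rewrite big_const_seq count_predT iter_addn_0 -cardE mulnC.
Qed.

(** The chain above the equations comes from a maximal set B of independent series
    at the generic point of X; the coefficients us of the polynomials P_i for i in B,
    without the pivots, generate a field over which all coordinates of the generic
    point of E are algebraic. *)
Lemma bounded_points_chain (k : fieldType) (n : nat)
    (eqs : set {mpoly (laurent k)[n]}) (d h r : nat) :
  prime_chain (vanishing (@bounded_points k n (zeros eqs) d h)) r ->
  exists2 s, prime_chain eqs s & (r <= s * (d * h + d + h))%N.
Proof.
set N := (n * (1 + dimN d h))%N.
move=> [P [Pprime Pinc]]; pose E : set (affine k N) := @bounded_points k n (zeros eqs) d h.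
have P0pr : is_prime (P 0%N) by have [] := Pprime 0%N isT.
have EP0 p : vanishing E p -> p \in P 0%N by have [_ _] := Pprime 0%N isT; apply.
have [K [ev [evE evP]]] := generic_point P0pr EP0.
have /choice[br brP] : forall z : affine k N, exists br : 'I_n -> branch k,
    (forall i, branch_bounds d h (br i)) /\
    (E z -> (forall i, is_branch (br i) (row i (vec_mx (z : 'rV[k]_N)))) /\
      zeros eqs (\row_i tofrac (br_f (br i)))).
  move=> z; have [[f [fX fA fz]]|nEz] := pselect (E z).
    have /choice[br brE] : forall i, exists b, [/\ br_f b = f i,
        branch_bounds d h b & is_branch b (row i (vec_mx (z : 'rV[k]_N)))].
      by move=> i; apply: coordinates_branch.
    exists br; split=> [i|_]; first by case: (brE i).
    split=> [i|]; first by case: (brE i).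
    rewrite (_ : (\row_i _) = \row_i tofrac (f i)) //.
    by apply/rowP => i; rewrite !mxE; have [->] := brE i.
  exists (fun=> Branch 0 0 0 0 0); split=> // i.
  by split; rewrite /= ?size_poly0 ?sizeYE ?rmorph0 ?size_poly0.
have brb z i : branch_bounds d h (br z i) by case: (brP z) => + _; apply.
have brE z : E z -> forall i, is_branch (br z i) (row i (vec_mx (z : 'rV[k]_N))).
  by move=> Ez; have [_ /(_ Ez)[]] := brP z.
pose F := generic_f br ev.
(* the generic point of X and its ideal Q *)
have [G [psi [GE psiC psiX psi0]]] := laurent_point evE (fun z i => br_f (br z i)).
have poll := mpoly_polynomial_ring (laurent k) n.
pose Q : {pred {mpoly (laurent k)[n]}} := [pred u | psi u == 0].
have Qpr : is_prime Q by apply: ker_prime.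
have QE u : (psi u == 0) = (u \in Q) by [].
have eqsQ p : eqs p -> p \in Q.
  move=> pe; rewrite inE psi0 // => z Ez.
  have [_ /(_ Ez)[_ /(_ p pe)]] := brP z.
  by move=> <-; apply: meval_eq => i; rewrite mxE.
have ind0 : indep poll psi finset.set0 by apply: indep0.
have [B [_ indB maxB]] := extend_indep ((indep_modE _ _ QE).1 ind0).
exists #|B|.
  have [P' [P'0 P'pr P'inc]] := chain_above Qpr indB (leqnn _).
  have eqsP' i : (i <= #|B|)%N -> forall p, eqs p -> p \in P' i.
    elim: i => [|i IHi] lei p pe; first by rewrite P'0; apply: eqsQ.
    by have [sub _] := P'inc i lei; apply/sub/IHi => //; apply: ltnW.
  exists P'; split=> // i lei; have [? ?] := P'pr i lei; split=> //.
  exact: eqsP'.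
(* the generic point of E *)
have polk := mpoly_polynomial_ring k N.
have [g gE] := const_rmorphism ev.
have [phi [phiC phiX]] := polynomial_ring_eval polk g
  (fun j => ev (fun z : 'rV[k]_N => z 0 j)).
have phiE q : phi q = ev (fun z : 'rV[k]_N => meval (fun j => z 0 j) q).
  by apply: (rmorph_meval (T := ev)) => [a|j]; rewrite ?phiC ?gE ?phiX.
have [B0 indB0 <-] : exists2 B0, indep_mod polk (P 0%N) B0 & #|B0| = r.
  by apply: (chain_indep polk) => // i /Pprime[].
have {}indB0 : indep polk phi B0.
  by move=> p pB phip; apply: indB0 => //; apply: evP; rewrite -phiE.
have /choice[piv pivP] := generic_P_pivot brb brE evE.
pose coefP i (ij : 'I_d.+1 * 'I_h.+1) := (generic_P br ev i)`_ij.1`_ij.2.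
pose us := [seq coefP i ij | i <- enum B, ij <- enum [set~ piv i]].
have -> : (#|B| * (d * h + d + h))%N = size us.
  rewrite size_allpairs_setC1 card_prod !card_ord mulSn mulnS /=.
  by congr (_ * _)%N; rewrite [RHS]addnC [in RHS](addnC d).
apply: (indep_bound indB0); set C := rcl _ => j; rewrite phiX.
have Ccl : closed_subfield C by apply: rcl_closed.
have Cconst a : ev (fun=> a) \in C.
  by apply: sub_rcl; rewrite inE; apply/orP; left; apply/asboolP; exists a; rewrite phiC gE.
have Csub := divring_subring Ccl.1.
have FB i : i \in B -> F i \in fps_over C.
  move=> iB; apply: (generic_f_over brb brE evE Ccl) => a l.
  have C0 : 0 \in C by have [C1 CB _] := Csub; rewrite -(subrr 1); apply: CB.
  rewrite coef_poly; case: ltnP => la; last by rewrite coef0.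
  rewrite coef_poly; case: ltnP => lb //; rewrite -(coef_generic_P brb).
  pose ij := (Ordinal la, Ordinal lb); have [pij|pij] := eqVneq (piv i) ij.
    by have := pivP i; rewrite pij /= => ->; case: Csub.
  apply: sub_rcl; rewrite inE; apply/orP; right.
  by apply/allpairsPdep; exists i, ij; rewrite !mem_enum !inE eq_sym pij iB.
apply: (coordinate_over brb brE evE Ccl Cconst) => i.
have [iB|iB] := boolP (i \in B); first exact: FB.
apply: (algebraic_fps_over (A := gen poll psi B)) => //.
  apply: gen_min.
  - exact: divring_subring (fractions_closed (series_pred_subring Csub)).
  - move=> u; rewrite psiC; have [a [b [b0 ->]]] := fractionP u.
    have overC c : tofrac (fps_transfer ev (fun=> c)) \in
        [pred u : laurent K | `[< exists2 f : fps K, f \in fps_over C & u = tofrac f >]].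
      apply/asboolP; exists (fps_transfer ev (fun=> c)) => //.
      by apply/fps_overP => l; apply: Cconst.
    apply/asboolP; exists (G (tofrac a)), (G (tofrac b)).
    by rewrite fmorph_div fmorph_eq0 tofrac_eq0 b0 !GE; split=> //; apply: overC.
  - move=> j' jB; rewrite psiX; apply: sub_fractions; first exact: series_pred_subring.
    by apply/asboolP; exists (F j') => //; apply: FB.
rewrite -[tofrac _]/(tofrac (F i)) -psiX; apply: dep_algebraic => //.
  by apply/(indep_modE _ _ QE).
by move=> ind; apply: (maxB i iB); apply/(indep_modE _ _ QE).
Qed.

Theorem theorem3p1 (k : closedFieldType) (n : nat)
    (eqs : set {mpoly (laurent k)[n]}) (X : set 'rV[laurent k]_n)
    (m : \bar int)
    (defX : X = zeros eqs) (dimX : krull_dim eqs = m) (d h : nat) :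
  (ndh d h X <= m * (d * h + d + h)%N%:Z%:E)%E.
Proof.
rewrite -dimX defX; apply: krull_dim_le => r [P [Ppr Pinc]].
have [|s seqs rs] := @bounded_points_chain k n eqs d h r.
  exists P; split=> // i /Ppr[Pid Pp Pvan]; split=> // p pE.
  by apply: Pvan => z; apply.
apply: (@le_trans _ _ (s%:Z%:E * (d * h + d + h)%N%:Z%:E)%E).
  by rewrite -EFinM lee_fin -PoszM lez_nat.
by apply: lee_wpmul2r; [rewrite lee_fin|apply: prime_chain_le].
Qed.
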